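(* Let $0=t_0<t_1<\cdots<t_N=T$ with $N\ge1$. Suppose that a state reduction $\big(\{\mathbb{X}_{t_i}\}_{0\le i\le N},\{\theta_{t_i}\}_{0\le i\le N},\{f_{t_i:t_{i+1}}\}_{0\le i\le N-1}\big)$ exists across the consecutive time blocks $\{t_i,\dots,t_{i+1}\}$, $i=0,\dots,N-1$, which is compatible with the stochastic kernels $\{\rho_{s-1:s}\}_{1\le s\le T}$. Let $\ell_{t_i}:\mathbb{X}_{t_i}\times\mathbb{H}_{t_i+1:t_{i+1}}\to[0,+\infty]$ ($0\le i\le N-1$) and $\ell_{t_N}:\mathbb{X}_{t_N}\to[0,+\infty]$ be lower semianalytic, and let the cost criterion be $$j(h_T)=\sum_{i=0}^{N-1}\ell_{t_i}\big(\theta_{t_i}(h_{t_i}),h_{t_i+1:t_{i+1}}\big)+\ell_{t_N}\big(\theta_{t_N}(h_{t_N})\big).$$ Define the associated value functions by $V_{t_N}(h_{t_N})=\ell_{t_N}(\theta_{t_N}(h_{t_N}))$ and, for $0\le i\le N-1$ and $h_{t_i}\in\mathbb{H}_{t_i}$, $$V_{t_i}(h_{t_i})=\inf_{\gamma\in\Gamma_{t_i:T-1}}\int_{\mathbb{H}_T}\Big(\sum_{k=i}^{N-1}\ell_{t_k}\big(\theta_{t_k}(h'_{t_k}),h'_{t_k+1:t_{k+1}}\big)+\ell_{t_N}\big(\theta_{t_N}(h'_{t_N})\big)\Big)\rho^\gamma_{t_i:T}(dh'_T\mid h_{t_i}).$$ Define $\tilde V_{t_i}:\mathbb{X}_{t_i}\to[0,+\infty]$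 by $\tilde V_{t_N}=\ell_{t_N}$ and $\tilde V_{t_i}=\overline{\mathcal B}_{t_{i+1}:t_i}\tilde V_{t_{i+1}}$ for $0\le i\le N-1$, where, for $\tilde\varphi\in L^0_+(\mathbb{X}_{t_{i+1}})$ and $x\in\mathbb{X}_{t_i}$, writing $r=t_i$, $t=t_{i+1}$, $(\overline{\mathcal B}_{t:r}\tilde\varphi)(x)$ is the nested sequence of infima of integrals $$\inf_{u_r\in\mathbb{U}_r}\int_{\mathbb{W}_{r+1}}\tilde\rho_{r:r+1}(dw_{r+1}\mid x)\ \inf_{u_{r+1}\in\mathbb{U}_{r+1}}\int_{\mathbb{W}_{r+2}}\tilde\rho_{r+1:r+2}(dw_{r+2}\mid x,u_r,w_{r+1})\cdots\inf_{u_{t-1}\in\mathbb{U}_{t-1}}\int_{\mathbb{W}_t}\tilde\rho_{t-1:t}(dw_t\mid x,u_r,w_{r+1},\dots,u_{t-2},w_{t-1})$$ $$\Big(\ell_r(x,u_r,w_{r+1},\dots,u_{t-1},w_t)+\tilde\varphi\big(f_{r:t}(x,u_r,w_{r+1},\dots,u_{t-1},w_t)\big)\Big).$$ Then $V_{t_i}=\tilde V_{t_i}\circ\theta_{t_i}$ for all $i=0,\dots,N$.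
   Context: Setting. $T\ge1$ is an integer. Borel space: a Borel subset of a Polish space (up to homeomorphism) with its Borel $\sigma$-field. $\Delta(\mathbb Y)$ is the Borel space of probability measures on a Borel space $\mathbb Y$. A function $\varphi:\mathbb{X}\to[0,+\infty]$ on a Borel space is lower semianalytic if $\{\varphi<c\}$ is an analytic set for every $c\in\mathbb{R}$; $L^0_+(\mathbb{X})$ denotes the set of such functions. A map between Borel spaces is universally measurable if preimages of Borel sets belong to the universal $\sigma$-field (the intersection of the completions of the Borel $\sigma$-field under all Borel probability measures). Integrals of universally measurable functions are taken with respect to completed measures; $\inf\emptyset=+\infty$. Histories. $\mathbb{U}_t$ ($0\le t\le T-1$) and $\mathbb{W}_t$ ($0\le t\le T$) are Borel spaces (controls, uncertainties). $\mathbb{H}_t=\mathbb{W}_0\times\prod_{s=1}^t(\mathbb{U}_{s-1}\times\mathbb{W}_s)$, with elements $h_t=(w_0,u_0,w_1,\dots,u_{t-1},w_t)$; $\mathbb{H}_{r:s}=\prod_{\tau=r}^s(\mathbb{U}_{\tau-1}\times\mathbb{W}_\tau)$ with elements $h_{r:s}=(u_{r-1},w_r,\dots,u_{s-1},w_s)$, so $h_t=(h_{r},h_{r+1:t})$; sub-histories $h_s$, $h_{r:s}$ of $h_T$ are the corresponding components. For $1\le t\le T$, $\rho_{t-1:t}:\mathbb{H}_{t-1}\to\Delta(\mathbb{W}_t)$ is a Borel-measurable stochastic kernel, written $\rho_{t-1:t}(dw_t\mid h_{t-1})$. $\Gamma_{t:T-1}$ is the set of sequences $\gamma=(\gamma_s)_{t\le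 s\le T-1}$ of universally measurable maps $\gamma_s:\mathbb{H}_s\to\mathbb{U}_s$. For $\gamma\in\Gamma_{t:T-1}$ and $h_t\in\mathbb{H}_t$, $\rho^\gamma_{t:T}(\cdot\mid h_t)\in\Delta(\mathbb{H}_T)$ is the law of the history $h_T$ obtained from $h_t$ by $u_s=\gamma_s(h_s)$, $w_{s+1}\sim\rho_{s:s+1}(\cdot\mid h_s)$, $h_{s+1}=(h_s,u_s,w_{s+1})$, $s=t,\dots,T-1$. State reduction. The family $\big(\{\mathbb{X}_{t_i}\},\{\theta_{t_i}\},\{f_{t_i:t_{i+1}}\}\big)$ consists of Borel spaces $\mathbb{X}_{t_i}$, Borel-measurable maps $\theta_{t_i}:\mathbb{H}_{t_i}\to\mathbb{X}_{t_i}$, and Borel-measurable maps $f_{t_i:t_{i+1}}:\mathbb{X}_{t_i}\times\mathbb{H}_{t_i+1:t_{i+1}}\to\mathbb{X}_{t_{i+1}}$. It is a state reduction across the consecutive time blocks if, for all $i=0,\dots,N-1$ and all $h_{t_{i+1}}=(h_{t_i},h_{t_i+1:t_{i+1}})\in\mathbb{H}_{t_{i+1}}$, $\theta_{t_{i+1}}(h_{t_{i+1}})=f_{t_i:t_{i+1}}(\theta_{t_i}(h_{t_i}),h_{t_i+1:t_{i+1}})$. It is compatible with the kernels if for every $i=0,\dots,N-1$ there are Borel-measurable reduced kernels $\tilde\rho_{t_i:t_i+1}:\mathbb{X}_{t_i}\to\Delta(\mathbb{W}_{t_i+1})$ and $\tilde\rho_{s-1:s}:\mathbb{X}_{t_i}\times\mathbb{H}_{t_i+1:s-1}\to\Delta(\mathbb{W}_s)$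 for $t_i+2\le s\le t_{i+1}$, with $\rho_{t_i:t_i+1}(dw\mid h_{t_i})=\tilde\rho_{t_i:t_i+1}(dw\mid\theta_{t_i}(h_{t_i}))$ and $\rho_{s-1:s}(dw\mid (h_{t_i},h_{t_i+1:s-1}))=\tilde\rho_{s-1:s}(dw\mid\theta_{t_i}(h_{t_i}),h_{t_i+1:s-1})$ for all histories. *)

(* Defs.v *)
From HB Require Import structures.
From mathcomp Require Import all_boot all_order all_algebra.
From mathcomp Require Import all_classical all_reals all_analysis.
From mathcomp Require Import measurable_realfun.
Set Implicit Arguments.
Unset Strict Implicit.
Unset Printing Implicit Defensive.
Import Order.TTheory GRing.Theory Num.Theory.
Import numFieldNormedType.Exports.
Local Open Scope classical_set_scope.
Local Open Scope ring_scope.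
Local Open Scope ereal_scope.

Record measurableSpace := MeasurableSpace {
  mspace_display : measure_display ;
  mspace_sort :> measurableType mspace_display }.

(* X is identified, through e, with a Borel subset of a Polish space P; the
   topology of X is the one transported along e (so that e is a homeomorphism
   onto its range), hence the last clause says that the sigma-field of X is its
   Borel sigma-field.  A Hausdorff pseudometric space is a metric space.
   Since measurable types are pointed, Borel spaces are nonempty. *)
Definition borel_embeddable (R : realType) (X : measurableSpace) : Prop :=
  exists (P : completePseudoMetricType R) (e : X -> P),
    [/\ hausdorff_space P /\ (exists2 D : set P, countable D & dense D),
        injective e,
        <<s @open P >> (range e) &
        @measurable _ X = [set e @^-1` B | B in <<s @open P >>]].

Record borelSpace (R : realType) := BorelSpace {
  bspace_space :> measurableSpace ;
  bspaceP : borel_embeddable R bspace_space }.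

Section universal_measurability.
Context {R : realType}.

Definition analytic d (X : measurableType d) (A : set X) : Prop :=
  exists (Y : borelSpace R) (B : set (X * Y)), measurable B /\ A = fst @` B.

Definition lower_semianalytic d (X : measurableType d) (phi : X -> \bar R) :
    Prop :=
  (forall x, 0 <= phi x) /\
  forall c : R, analytic [set x | phi x < c%:E].

Definition universally_measurable_set d (X : measurableType d) (A : set X) :
    Prop :=
  forall P : probability X R, completed_algebra_gen P A.

Definition universally_measurable d1 d2 (X : measurableType d1)
    (Y : measurableType d2) (g : X -> Y) : Prop :=
  forall B, measurable B -> universally_measurable_set (g @^-1` B).

(* The integral with respect to the completion of mu: the sigma-field is the
   completed one, on which the completion coincides with the outer measure. *)
Definition completed_integral d (X : measurableType d) (mu : set X -> \bar R)
    (phi : X -> \bar R) : \bar R :=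
  @integral _ (g_sigma_algebraType (completed_algebra_gen mu)) R
    (mu^*)%mu setT phi.

End universal_measurability.
Arguments universally_measurable_set R {d X} A.
Arguments universally_measurable R {d1 d2 X Y} g.

Section histories.
Context {R : realType} (U W : nat -> borelSpace R).

Fixpoint hist (t : nat) : measurableSpace :=
  match t with
  | 0 => W 0
  | s.+1 => MeasurableSpace (hist s * U s * W s.+1)%type
  end.

(* block r n is H_{r+1:r+n}, with elements
   (u_r, w_{r+1}, .., u_{r+n-1}, w_{r+n}).  Indices are written n + r, for which
   n.+1 + r and (n + r).+1 are convertible; block r 0 is a one-point space. *)
Fixpoint block (r n : nat) : measurableSpace :=
  match n with
  | 0 => MeasurableSpace unit
  | m.+1 => MeasurableSpace (block r m * U (m + r) * W (m + r).+1)%type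
  end.

Fixpoint hist_cat (r n : nat) (h : hist r) : block r n -> hist (n + r) :=
  match n return block r n -> hist (n + r) with
  | 0 => fun _ => h
  | m.+1 => fun b => (hist_cat h b.1.1, b.1.2, b.2)
  end.

Fixpoint hist_past (r n : nat) : hist (n + r) -> hist r :=
  match n return hist (n + r) -> hist r with
  | 0 => fun h => h
  | m.+1 => fun h => hist_past h.1.1
  end.

Fixpoint hist_future (r n : nat) : hist (n + r) -> block r n :=
  match n return hist (n + r) -> block r n with
  | 0 => fun _ => tt
  | m.+1 => fun h => (hist_future h.1.1, h.1.2, h.2)
  end.

Definition hist_cast (s t : nat) (e : s = t) : hist s -> hist t :=
  match e in _ = t0 return hist s -> hist t0 with erefl => fun h => h end.

Definition hist_join (r t : nat) (le_rt : (r <= t)%N) (h : hist r)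
    (b : block r (t - r)) : hist t :=
  hist_cast (subnK le_rt) (hist_cat h b).

(* the components h_r and h_{r+1:t} of h_t *)
Definition subhist (r t : nat) (le_rt : (r <= t)%N) (h : hist t) : hist r :=
  hist_past (hist_cast (esym (subnK le_rt)) h).

Definition subblock (r t : nat) (le_rt : (r <= t)%N) (h : hist t) :
    block r (t - r) :=
  hist_future (hist_cast (esym (subnK le_rt)) h).

(* Only the components gamma s with r <= s < t are constrained (and used). *)
Definition policies (r t : nat) : set (forall s, hist s -> U s) :=
  [set gamma | forall s, (r <= s < t)%N ->
     universally_measurable R (gamma s)].

Variable rho : forall s, R.-pker (hist s) ~> (W s.+1).

(* The law of h_{r+n} obtained from h_r under gamma; the integral is a completed
   one because gamma is only universally measurable.  For gamma in policies it
   is a probability measure on the measurable sets. *)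
Fixpoint policy_law (gamma : forall s, hist s -> U s) (r : nat) (h : hist r)
    (n : nat) : set (hist (n + r)) -> \bar R :=
  match n return set (hist (n + r)) -> \bar R with
  | 0 => fun A => \d_h A
  | m.+1 => fun A : set (hist (m + r) * U (m + r) * W (m + r).+1) =>
      completed_integral (@policy_law gamma r h m)
        (fun h' => rho (m + r) h' [set w | A (h', gamma (m + r)%N h', w)])
  end.

Definition policy_law_until (gamma : forall s, hist s -> U s) (r t : nat)
    (le_rt : (r <= t)%N) (h : hist r) : set (hist t) -> \bar R :=
  pushforward (policy_law gamma h (n := t - r)) (hist_cast (subnK le_rt)).

End histories.
Arguments policies {R} U W r t _.

Record time_grid (N T : nat) := TimeGrid {
  node :> nat -> nat ;
  node0 : node 0%N = 0%N ;
  nodeN : node N = T ;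
  node_lt : forall i, (i < N)%N -> (node i < node i.+1)%N }.

Lemma node_leT (N T : nat) (t : time_grid N T) (i : nat) :
  (i <= N)%N -> (t i <= T)%N.
Proof.
case: t => t /= _ <- + iN.
elim: N iN => [|n IHn]; first by rewrite leqn0 => /eqP ->.
rewrite leq_eqVlt => /predU1P[-> //|iN] t_lt.
apply: leq_trans (IHn iN _) (ltnW (t_lt n _)) => // j jn.
exact: t_lt (ltnW jn).
Qed.

Section state_reduction.
Context {R : realType} (U W X : nat -> borelSpace R) (N T : nat).
Variable t : time_grid N T.

Definition time_block (i : nat) : measurableSpace :=
  block U W (t i) (t i.+1 - t i).

Variable theta : forall i, hist U W (t i) -> X i.
Variable f : forall i, X i * time_block i -> X i.+1.

Definition is_state_reduction : Prop :=
  [/\ forall i, (i <= N)%N -> measurable_fun setT (theta (i := i)),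
      forall i, (i < N)%N -> measurable_fun setT (f (i := i)) &
      forall i (iN : (i < N)%N) (h : hist U W (t i)) (b : time_block i),
        theta (hist_join (ltnW (node_lt t iN)) h b) = f (theta h, b)].

Variable rho : forall s, R.-pker (hist U W s) ~> (W s.+1).

(* rhot i n is the reduced kernel giving the law of w_{t_i+n+1}; for n = 0 the
   second factor of its domain is the one-point space. *)
Variable rhot : forall i n,
  R.-pker (X i * block U W (t i) n) ~> (W (n + t i).+1).

Definition compatible_kernels : Prop :=
  forall i n, (i < N)%N -> (n < t i.+1 - t i)%N ->
  forall (h : hist U W (t i)) (b : block U W (t i) n)
         (A : set (W (n + t i).+1)), measurable A ->
    rho (n + t i) (hist_cat h b) A = rhot i n (theta h, b) A.

Variable ell : forall i, X i * time_block i -> \bar R.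
Variable ellN : X N -> \bar R.

(* For i = 0 this is the full cost criterion. *)
Definition tail_cost (i : nat) (h : hist U W T) : \bar R :=
  \sum_(k < N | (i <= k)%N)
    ell (theta (subhist (node_leT t (ltnW (ltn_ord k))) h),
         subblock (ltnW (node_lt t (ltn_ord k)))
                  (subhist (node_leT t (ltn_ord k)) h))
  + ellN (theta (subhist (node_leT t (leqnn N)) h)).

Definition is_value_function (V : forall i, hist U W (t i) -> \bar R) : Prop :=
  (forall h : hist U W (t N), V N h = ellN (theta h)) /\
  forall i (iN : (i < N)%N) (h : hist U W (t i)),
    V i h = ereal_inf
      [set completed_integral
             (policy_law_until rho gamma (node_leT t (ltnW iN)) h)
             (tail_cost i)
      | gamma in policies U W (t i) T].

(* The n nested infima of integrals applied to a function of the history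
   (u_{t_i}, w_{t_i+1}, .., u_{t_i+n-1}, w_{t_i+n}), peeled from the inside. *)
Fixpoint nested_inf (i : nat) (x : X i) (n : nat) :
    (block U W (t i) n -> \bar R) -> \bar R :=
  match n return (block U W (t i) n -> \bar R) -> \bar R with
  | 0 => fun phi => phi tt
  | m.+1 => fun phi => nested_inf x (fun b : block U W (t i) m =>
      ereal_inf [set completed_integral (rhot i m (x, b))
                       (fun w => phi (b, u, w))
                | u in [set: U (m + t i)]])
  end.

Definition bellman (i : nat) (phi : X i.+1 -> \bar R) (x : X i) : \bar R :=
  nested_inf x (fun b : time_block i => ell (x, b) + phi (f (x, b))).

Definition is_reduced_value_function (Vt : forall i, X i -> \bar R) : Prop :=
  (forall x, Vt N x = ellN x) /\
  forall i, (i < N)%N -> forall x, Vt i x = bellman (Vt i.+1) x.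

End state_reduction.

(* Main.v *)
Require Import Defs.
From HB Require Import structures.
From mathcomp Require Import all_boot all_order all_algebra.
From mathcomp Require Import all_classical all_reals all_analysis.
From mathcomp Require Import measurable_realfun.
From mathcomp Require Import lra.
Set Implicit Arguments.
Unset Strict Implicit.
Unset Printing Implicit Defensive.
Import Order.TTheory GRing.Theory Num.Theory.
Import numFieldNormedType.Exports.
Local Open Scope classical_set_scope.
Local Open Scope ring_scope.
Local Open Scope ereal_scope.

(* A set is called souslin when it is the projection of a measurable subset of
   X * Baire; every Borel space is a measurable image of the Baire space, so
   analytic sets are souslin.  Unfolding measurable subsets of X * Baire into
   trees gives a capacitability argument: a souslin set of outer measure > r
   contains a measurable set of measure >= r, of the form "intersection of the
   boxes below some branch a".  Hence souslin sets are universally measurable,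
   and integration against a Borel kernel preserves lower semianalytic
   functions, since "measure > r" becomes an existential over a.  The leftmost
   branch of the tree is a universally measurable uniformization.
   With these tools, the backward recursion on histories stays lower
   semianalytic, has universally measurable epsilon-optimal selectors, and its
   value at time r is the infimum over policies.  For the tail cost of block i
   it is constant in the cost already incurred, and along one block it only
   sees the history through theta by compatibility of the kernels, so that it
   unwinds into the Bellman operator. *)

(** * Completed measures and completed integrals *)

Section completion.
Context {R : realType}.

(** The measure arguments use no topology: a set is described by countably many conditions, each of
    which reads finitely many coordinates of a sequence, and this finiteness stands in for
    compactness. Integrands and policies are measurable only off null sets that depend on the law at
    hand. The proof therefore leans on the monotonicity of integrals defined as suprema over simple
    functions, valid for arbitrary nonnegative functions, and brings in a Borel version for one law
    at a time. Optimal controls need not exist and values may be infinite, so each stage is solved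
    up to an error, and the errors are spread over the stages. Measurability is settled on
    histories; the reduced functions are then identified with the recursion pointwise. *)

Lemma lte_ratP (a b : \bar R) : a < b ->
  exists q : rat, a < (ratr q)%:E /\ (ratr q)%:E < b.
Proof.
case: a b => [a| |] [b| |] // ab; rewrite ?lte_fin in ab.
- by have [q] := rat_in_itvoo ab; rewrite in_itv/= => /andP[? ?]; exists q;
    rewrite !lte_fin.
- have : (a < a + 1)%R by rewrite ltrDl.
  by move=> /rat_in_itvoo[q]; rewrite in_itv/= => /andP[? _]; exists q;
    rewrite lte_fin ltry.
- have : (b - 1 < b)%R by rewrite ltrBlDr ltrDl.
  by move=> /rat_in_itvoo[q]; rewrite in_itv/= => /andP[_ ?]; exists q;
    rewrite lte_fin ltNyr.
- by exists 0%Q; rewrite ltNyr ltry.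
Qed.

Lemma measurable_fun_lt_rat d (T : measurableType d) (D : set T)
    (f : T -> \bar R) :
  (forall q : rat, measurable (D `&` [set x | f x < (ratr q)%:E])) ->
  measurable_fun D f.
Proof.
move=> mf mD; apply: (measurability _ (ErealGenInftyO.measurableE R)) => //.
move=> _ [_ [r ->] <-].
rewrite [X in measurable X](_ : _ = \bigcup_(q : rat)
    (if (ratr q < r)%R then D `&` [set x | f x < (ratr q)%:E] else set0)).
  by apply: bigcupT_measurable_rat => q; case: ifP.
apply/seteqP; split => x /=; rewrite in_itv/=.
  move=> [Dx fxr]; have [q [fq qr]] := lte_ratP fxr.
  by exists q => //; rewrite lte_fin in qr; rewrite qr.
move=> [q _]; case: ifP => // qr [Dx /= fq]; split => //.
by rewrite (lt_trans fq) ?lte_fin.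
Qed.

Definition countably_generated d (Y : measurableType d) :=
  exists E : nat -> set Y, @measurable _ Y = <<s range E>>.

Section completed_sets.
Context d (X : measurableType d) (mu : {measure set X -> \bar R}).

(** Removing one null set, instead of adding part of one, turns the closure properties of the
    completed sigma-field into plain set computations. *)
Lemma completed_algebra_genP (A : set X) : completed_algebra_gen mu A <->
  exists N, [/\ measurable N, mu N = 0 & measurable (A `\` N)].
Proof.
split=> [[B mB [M [N [mN N0 MN]] <-]]|[N [mN N0 mAN]]].
- exists N; split => //.
  rewrite (_ : _ `\` _ = B `\` N); first exact: measurableD.
  apply/seteqP; split=> x /=; last by move=> [Bx Nx]; split => //; left.
  by move=> [[//|/MN] ? ?].
- exists (A `\` N) => //; exists (A `&` N).
    by exists N; split => // x [].
  apply/seteqP; split=> [x [[]|[]]//|x Ax].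
  by have [Nx|Nx] := pselect (N x); [right|left].
Qed.

Lemma sigma_algebra_completed : sigma_algebra setT (completed_algebra_gen mu).
Proof.
split.
- by apply/completed_algebra_genP; exists set0; rewrite measure0 set0D.
- move=> A /completed_algebra_genP[N [mN N0 mA]]; rewrite setTD.
  apply/completed_algebra_genP; exists N; split => //.
  rewrite (_ : _ `\` _ = ~` (A `\` N) `\` N); last first.
    apply/seteqP; split => x/= [H Nx]; split => //; first by case.
    by move=> Ax; apply: H.
  by apply: measurableD => //; exact: measurableC.
- move=> A mA.
  have /choice[N NP] n : exists N, [/\ measurable N, mu N = 0 &
    measurable (A n `\` N)] by exact/completed_algebra_genP.
  apply/completed_algebra_genP; exists (\bigcup_n N n); split.
  + by apply: bigcupT_measurable => n; have [] := NP n.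
  + apply/negligibleP; first by apply: bigcupT_measurable => n; have [] := NP n.
    apply: negligible_bigcup => n; apply/negligibleP; by have [] := NP n.
  + rewrite (_ : _ `\` _ = (\bigcup_n (A n `\` N n)) `\` \bigcup_n N n).
      apply: measurableD; apply: bigcupT_measurable => n; by have [] := NP n.
    apply/seteqP; split => x/= [[n _ H] Nx]; split => //; exists n => //.
      by split => // Nn; apply: Nx; exists n.
    by case: H.
Qed.

Definition completed_type := g_sigma_algebraType (completed_algebra_gen mu).
HB.instance Definition _ := Measurable.on completed_type.

Lemma completed_measurableE :
  @measurable _ completed_type = completed_algebra_gen mu.
Proof. exact: measurable_g_measurableTypeE sigma_algebra_completed. Qed.

Lemma completed_measurableP (A : set X) : @measurable _ completed_type A <->
  exists N, [/\ measurable N, mu N = 0 & measurable (A `\` N)].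
Proof. by rewrite completed_measurableE; exact: completed_algebra_genP. Qed.

Lemma measurable_completed (A : set X) : measurable A ->
  @measurable _ completed_type A.
Proof.
by move=> mA; apply/completed_measurableP; exists set0; rewrite measure0 setD0.
Qed.

Lemma measurable_fun_completed d' (Y : measurableType d') (f : X -> Y) :
  measurable_fun setT f -> measurable_fun setT (f : completed_type -> Y).
Proof.
move=> mf _ B mB; apply: measurable_completed; exact: mf.
Qed.

(** Each member of a generating sequence has a preimage that is measurable off its own null set; the
    union of these countably many null sets serves for all of them. This is how universally
    measurable policies become Borel off a null set. *)
Lemma completed_fun_measurable d' (Y : measurableType d')
    (f : completed_type -> Y) : countably_generated Y ->
  measurable_fun setT f ->
  exists N : set X, [/\ measurable N, mu N = 0 &
    measurable_fun (~` N) (f : X -> Y)].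
Proof.
move=> [E YE] mf.
have /choice[N NP] n : exists N : set X, [/\ measurable N, mu N = 0 &
   measurable ((f @^-1` E n) `\` N : set X)].
  apply/completed_measurableP; rewrite -[X in measurable X]setTI.
  by apply: mf => //; rewrite YE; apply: sub_sigma_algebra; exists n.
have mN : measurable (\bigcup_n N n).
  by apply: bigcupT_measurable => n; have [] := NP n.
exists (\bigcup_n N n); split => //.
  apply/negligibleP => //.
  by apply: negligible_bigcup => n; apply/negligibleP; have [] := NP n.
move=> mNC; apply: (measurability _ YE) => //.
move=> _ [_ [n _ <-] <-].
rewrite (_ : _ `&` _ = ((f @^-1` E n) `\` N n) `\` \bigcup_n N n).
  by apply: measurableD => //; have [] := NP n.
apply/seteqP; split => x /= [H1 H2]; split => //.
  by split => // Nn; apply: H1; exists n.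
by case: H1.
Qed.

Lemma mu_ext_completed (A N : set X) : measurable N -> mu N = 0 ->
  measurable (A `\` N) -> (mu^*)%mu A = mu (A `\` N).
Proof.
move=> mN N0 mAN; apply/eqP; rewrite eq_le; apply/andP; split; last first.
  by rewrite -(measurable_mu_extE _ mAN); apply: le_mu_ext; exact: subDsetl.
apply: (@le_trans _ _ ((mu^*)%mu ((A `\` N) `|` N))).
  by apply: le_mu_ext => x Ax; have [Nx|Nx] := pselect (N x); [right|left].
apply: le_trans (outer_measureU2 _ _ _) _ => /=.
by rewrite !measurable_mu_extE//= N0 adde0.
Qed.

End completed_sets.

Lemma countably_generated_ereal : countably_generated (\bar R).
Proof.
exists (fun n => if unpickle n is Some q
  then [set y : \bar R | y < (ratr q)%:E] else set0).
apply/seteqP; split; last first.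
  apply: smallest_sub; first exact: sigma_algebra_measurable.
  move=> _ [n _ <-]; case: unpickle => // q.
  rewrite [X in measurable X](_ : _ = `]-oo, (ratr q)%:E[%classic).
    exact: emeasurable_itv.
  by apply/seteqP; split => x /=; rewrite in_itv.
rewrite [X in X `<=` _](ErealGenInftyO.measurableE R); apply: smallest_sub.
  exact: smallest_sigma_algebra.
move=> _ [r ->].
rewrite [X in <<s _ >> X](_ : _ = \bigcup_(q : rat)
    (if (ratr q < r)%R then [set y : \bar R | y < (ratr q)%:E] else set0)).
  apply: (@bigcupT_measurable_rat _ (g_sigma_algebraType
    (range (fun n => if unpickle n is Some q
      then [set y : \bar R | y < (ratr q)%:E] else set0)))) => q.
  case: ifP => // _; apply: sub_sigma_algebra.
  by exists (pickle q) => //; rewrite pickleK.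
apply/seteqP; split => x /=; rewrite in_itv/=.
  move=> fxr; have [q [fq qr]] := lte_ratP fxr.
  by exists q => //; rewrite lte_fin in qr; rewrite qr.
by move=> [q _]; case: ifP => // qr /= fq; rewrite (lt_trans fq) ?lte_fin.
Qed.

End completion.

Section completed_integral_theory.
Context {R : realType}.
Import HBSimple HBNNSimple.

Lemma nnsfun_of d (T : measurableType d) (f : T -> R) :
  measurable_fun setT f -> finite_set (range f) -> (forall x, 0 <= f x)%R ->
  exists h : {nnsfun T >-> R}, h = f :> (T -> R).
Proof.
move=> mf ff f0.
pose m1 := @isMeasurableFun.Build _ _ _ _ f mf.
pose m2 := @FiniteImage.Build _ _ f ff.
pose m3 := @isNonNegFun.Build _ _ f f0.
pose g : {nnsfun T >-> R} := HB.pack f m1 m2 m3.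
by exists g.
Qed.

Context d (X : measurableType d) (mu : {measure set X -> \bar R}).

(** Cutting [s] to 0 on a null set off which it is Borel only lowers it. The level set of 0 grows,
    but it has weight 0 in the integral; the other level sets change by null sets. *)
Lemma nnsfun_uncomplete (s : {nnsfun completed_type mu >-> R}) :
  exists h : {nnsfun X >-> R}, (forall x, h x <= s x)%R /\
    sintegral mu h = sintegral (mu^*)%mu s.
Proof.
have [|N [mN N0 ms]] := @completed_fun_measurable _ _ _ mu _ (\bar R)
  (EFin \o s)
  countably_generated_ereal.
  by apply/measurable_EFinP; exact: measurable_funPT.
have mNC : measurable (~` N) by exact: measurableC.
have [||x|h hE] := @nnsfun_of _ X ((s : X -> R) \_ (~` N)).
- by apply/(measurable_restrictT _ _).1 => //; exact/measurable_EFinP.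
- apply: (@sub_finite_set _ _ (range s `|` [set 0%R])).
    move=> _ [x _ <-]; rewrite patchE; case: ifP => _; [left|right] => //.
  by rewrite finite_setU; split => //; exact: fimfunP.
- by rewrite patchE; case: ifP.
exists h; split => [x|]; first by rewrite hE patchE; case: ifP => // _;
  exact: fun_ge0.
rewrite /sintegral; apply: eq_fsbigr => r _.
have [->|r0] := eqVneq r 0%R; first by rewrite !mul0e.
congr (_ * _).
have E : s @^-1` [set r] `\` N = h @^-1` [set r].
  rewrite hE; apply/seteqP; split => x /=; rewrite patchE.
    by move=> [<- Nx]; rewrite ifT// inE.
  case: ifPn => [|_ /esym/eqP]; first by rewrite inE.
  by rewrite (negbTE r0).
rewrite (mu_ext_completed mN N0) E//.
Qed.

Lemma nnsfun_complete (h : {nnsfun X >-> R}) :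
  exists s : {nnsfun completed_type mu >-> R}, (forall x, s x = h x) /\
    sintegral (mu^*)%mu s = sintegral mu h.
Proof.
have [| | |s sE] := @nnsfun_of _ (completed_type mu) h.
- exact: measurable_fun_completed.
- exact: (@fimfunP _ _ h).
- by [].
exists s; split => [x|]; first by rewrite sE.
rewrite /sintegral; apply: eq_fsbigr => r _; congr (_ * _).
by rewrite sE measurable_mu_extE.
Qed.

(* The integral of MathComp-Analysis is a supremum over simple functions below
   the integrand; simple functions for the completed sigma-field are a.e. equal
   to smaller Borel ones, so this holds for every integrand. *)
Lemma completed_integralE (f : X -> \bar R) :
  completed_integral mu f = \int[mu]_x f x.
Proof.
pose nnint d' (Y : measurableType d') (m : set Y -> \bar R) (g : Y -> \bar R) :=
  ereal_sup [set sintegral m h |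
    h in [set h : {nnsfun Y >-> R} | forall x, (h x)%:E <= g x]].
have E (g : X -> \bar R) :
    @nnint _ (completed_type mu) (mu^*)%mu g = @nnint _ X mu g.
  apply/eqP; rewrite eq_le; apply/andP; split;
    apply: ge_ereal_sup => _ [h hg <-].
    have [s [sh <-]] := nnsfun_uncomplete h.
    apply: ereal_sup_ubound; exists s => // x.
    by apply: le_trans (hg x); rewrite lee_fin.
  have [s [sh <-]] := nnsfun_complete h.
  by apply: ereal_sup_ubound; exists s => // x; rewrite sh.
exact: (congr2 (fun a b => a - b) (E _) (E _)).
Qed.

(** [policy_law] is a bare set function, and compatibility of kernels speaks of measurable sets
    only; both the completion and the outer measure are determined by the values there. *)
Lemma eq_completed_integral (m1 m2 : set X -> \bar R) (f : X -> \bar R) :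
  (forall A, measurable A -> m1 A = m2 A) ->
  completed_integral m1 f = completed_integral m2 f.
Proof.
move=> m12.
have Eg : completed_algebra_gen m1 = completed_algebra_gen m2.
  have sub (m m' : set X -> \bar R) : (forall A, measurable A -> m A = m' A) ->
      completed_algebra_gen m `<=` completed_algebra_gen m'.
    move=> mm' _ [A mA [N [B [mB B0 NB]] <-]]; exists A => //; exists N => //.
    by exists B; split => //; rewrite -mm'.
  by apply/seteqP; split; apply: sub => // A mA; rewrite m12.
have Em : (m1^*)%mu = (m2^*)%mu.
  apply/funext => A; rewrite /mu_ext; congr ereal_inf.
  by apply/seteqP; split => _ [B [mB AB] <-]; exists B => //;
    apply: eq_eseriesr => n _; rewrite m12.
by rewrite /completed_integral Em; move: Eg => ->.
Qed.

(** Every simple function below [f] is below [g]: monotonicity needs no measurability, so it applies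
    directly to lower semianalytic integrands. *)
Lemma ge0_le_integral_lower (f g : X -> \bar R) :
  (forall x, 0 <= f x) -> (forall x, f x <= g x) ->
  \int[mu]_x f x <= \int[mu]_x g x.
Proof.
move=> f0 fg; rewrite !ge0_integralTE//; last first.
  by move=> x; exact: le_trans (fg x).
apply: le_ereal_sup => _ [h hf <-]; exists h => // x.
exact: le_trans (fg x).
Qed.

(** A simple function below [f] keeps its integral when it is cut off on [N], and the result lies
    below [f] restricted to the complement. *)
Lemma ge0_integral_setC_null (f : X -> \bar R) (N : set X) :
  measurable N -> mu N = 0 -> (forall x, 0 <= f x) ->
  \int[mu]_x f x = \int[mu]_(x in ~` N) f x.
Proof.
move=> mN N0 f0; apply/eqP; rewrite eq_le; apply/andP; split; last first.
  rewrite integral_mkcond; apply: ge0_le_integral_lower => x; rewrite patchE;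
  by case: ifP.
rewrite ge0_integralTE//; apply: ge_ereal_sup => _ [h hf <-].
rewrite -integralT_nnsfun.
rewrite (_ : \int[mu]_x _ = \int[mu]_(x in ~` N) (h x)%:E); last first.
  rewrite (ge0_negligible_integral mN)// ?setTD//.
  - exact/measurable_EFinP.
  - by move=> x _; rewrite lee_fin; exact: fun_ge0.
rewrite integral_mkcond [leRHS]integral_mkcond.
apply: ge0_le_integral_lower => x; rewrite !patchE; case: ifP => // _.
by rewrite lee_fin; exact: fun_ge0.
Qed.

End completed_integral_theory.

(** * Souslin sets *)

Lemma preimage_measurable d1 d2 (X : measurableType d1) (Y : measurableType d2)
    (f : X -> Y) (B : set Y) :
  measurable_fun setT f -> measurable B -> measurable (f @^-1` B).
Proof. by move=> mf mB; rewrite -[X in measurable X]setTI; exact: mf. Qed.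

Definition cylinder (n m : nat) : set (nat -> nat) := [set a | a n = m].

Definition baire := g_sigma_algebraType
  [set A | exists n m, A = cylinder n m].
HB.instance Definition _ := Measurable.on baire.

Lemma measurable_cylinder n m : measurable (cylinder n m : set baire).
Proof. by apply: sub_sigma_algebra; exists n, m. Qed.

Lemma measurable_baire_coord n : measurable_fun setT (fun a : baire => a n).
Proof.
move=> _ B _; rewrite setTI (_ : _ @^-1` _ = \bigcup_m
    (if m \in B then cylinder n m else set0)).
  by apply: bigcupT_measurable => m; case: ifP => // _;
    exact: measurable_cylinder.
apply/seteqP; split => [a /= Ba|a [m _]].
  by exists (a n) => //; rewrite ifT ?inE.
by case: ifPn => // /[1!inE] Bm; rewrite /cylinder/= => ->.
Qed.

Lemma measurable_fun_baire d (X : measurableType d) (f : X -> baire) :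
  (forall n, measurable_fun setT (fun x => f x n)) -> measurable_fun setT f.
Proof.
move=> mf; have E : @measurable _ baire = <<s [set A | exists n m,
  A = cylinder n m] >> by [].
apply: (measurability _ E) => _ [_ [n [m ->]] <-].
exact: (mf n measurableT [set m]).
Qed.

(** Since [n] coordinates decide, the set is a countable union of rectangles, one for each finite
    sequence continued by zeros. *)
Lemma measurable_baire_finite d (X : measurableType d) (n : nat)
    (G : X -> (nat -> nat) -> Prop) :
  (forall a, measurable [set x | G x a]) ->
  (forall x a b, (forall i, (i < n)%N -> a i = b i) -> G x a -> G x b) ->
  measurable [set z : X * baire | G z.1 z.2].
Proof.
move=> mG finG.
rewrite (_ : [set _ | _] = \bigcup_(s : seq nat)
   ([set x | G x (nth 0%N s)] `*`
    [set b : baire | forall i, (i < n)%N -> b i = nth 0%N s i])).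
  apply: countable_bigcupT_measurable => // s; apply: measurableX => //.
  rewrite (_ : [set _ | _] = \bigcap_(i in [set i | (i < n)%N])
      cylinder i (nth 0%N s i)).
    by apply: bigcap_measurableType => i _; exact: measurable_cylinder.
  by apply/seteqP; split.
apply/seteqP; split => [[x a]/= Gxa|[x a] [s _ [/= Gs sa]]]; last first.
  by apply: finG Gs => i /sa.
exists (mkseq a n) => //; split => /=; last by move=> i ni; rewrite nth_mkseq.
by apply: finG Gxa => i ni; rewrite nth_mkseq.
Qed.

Section souslin.
Context d (X : measurableType d).

Definition souslin (A : set X) := exists B : set (X * baire),
  measurable B /\ A = [set x | exists a, B (x, a)].

Lemma souslin_measurable A : measurable A -> souslin A.
Proof.
move=> mA; exists (A `*` setT); split; first exact: measurableX.
by apply/seteqP; split=> x /=; [exists point|case=> ? []].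
Qed.

(** The head of the sequence names a set containing the point; the tail is the witness for that
    set. *)
Lemma souslin_bigcup (A : nat -> set X) :
  (forall n, souslin (A n)) -> souslin (\bigcup_n A n).
Proof.
move=> /choice[B BP].
exists (\bigcup_n ([set z : X * baire | z.2 0%N = n] `&`
  (fun z : X * baire => (z.1, (fun i => z.2 i.+1) : baire)) @^-1` B n)); split.
  apply: bigcupT_measurable => n; apply: measurableI.
    rewrite -[X in measurable X]setTI.
    have := @measurableT_comp _ _ _ _ _ _ _ _ _ (measurable_baire_coord 0)
      (@measurable_snd _ _ X baire).
    by move=> /(_ measurableT [set n]); exact.
  apply: preimage_measurable; last by have [] := BP n.
  apply: measurable_fun_pair => //; apply: measurable_fun_baire => i.
  exact: measurableT_comp (measurable_baire_coord i.+1) measurable_snd.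
apply/seteqP; split => [x [n _]|x /= [a [n _ [/= an Bn]]]]; last first.
  by exists n => //; rewrite (BP n).2; exists (fun i => a i.+1).
rewrite (BP n).2 /= => -[a Ba]; exists (fun i => if i is j.+1 then a j else n).
by exists n.
Qed.

(** A single sequence carries all the witnesses, the one for [A n] at the indices
    [pickle (n, i)]. *)
Lemma souslin_bigcap (A : nat -> set X) :
  (forall n, souslin (A n)) -> souslin (\bigcap_n A n).
Proof.
move=> /choice[B BP].
exists (\bigcap_n ((fun z : X * baire => (z.1, (fun i =>
  z.2 (pickle (n, i))) : baire)) @^-1` B n)).
split.
  apply: bigcapT_measurable => n.
  apply: preimage_measurable; last by have [] := BP n.
  apply: measurable_fun_pair => //; apply: measurable_fun_baire => i.
  exact: measurableT_comp (measurable_baire_coord _) measurable_snd.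
apply/seteqP; split => [x Ax|x /= [a Ba] n _]; last first.
  by rewrite (BP n).2; exists (fun i => a (pickle (n, i))); exact: Ba.
have /choice[a aP] n : exists a, B n (x, a).
  by have := Ax n I; rewrite (BP n).2.
exists (fun k => if unpickle k is Some p then a p.1 p.2 else 0%N) => n _ /=.
by under [X in B n (_, X)]eq_fun do rewrite pickleK/=.
Qed.

End souslin.

Lemma souslin_preimage d d' (X : measurableType d) (Y : measurableType d')
    (f : X -> Y) (A : set Y) :
  measurable_fun setT f -> souslin A -> souslin (f @^-1` A).
Proof.
move=> mf [B [mB ->]]; exists ((fun z : X * baire => (f z.1, z.2)) @^-1` B);
  split => //.
apply: preimage_measurable => //; apply: measurable_fun_pair => //.
exact: measurableT_comp mf measurable_fst.
Qed.

Lemma souslin_proj_baire d (X : measurableType d) (A : set (X * baire)) :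
  souslin A -> souslin [set x | exists a, A (x, a)].
Proof.
move=> [B [mB ->]].
exists ((fun z : X * baire =>
  (z.1, (fun i => z.2 i.*2) : baire, (fun i => z.2 i.*2.+1) : baire)) @^-1` B).
split.
  apply: preimage_measurable => //; apply: measurable_fun_pair => //.
    apply: measurable_fun_pair => //; apply: measurable_fun_baire => i.
    exact: measurableT_comp (measurable_baire_coord _) measurable_snd.
  apply: measurable_fun_baire => i.
  exact: measurableT_comp (measurable_baire_coord _) measurable_snd.
apply/seteqP; split => [x/= [a [b Bab]]|x/= [a Ba]]; last first.
  by exists (fun i => a i.*2), (fun i => a i.*2.+1).
pose c i := if odd i then b i./2 else a i./2.
have ca : (fun i => c i.*2) = a.
  by apply/funext => i; rewrite /c odd_double doubleK.
have cb : (fun i => c i.*2.+1) = b.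
  by apply/funext => i; rewrite /c/= odd_double/= uphalf_double.
by exists c; rewrite /= ca cb.
Qed.

(** * Unfolding measurable sets into finitely determined conditions *)

Section schemes.
Context d (X : measurableType d).

(* The sets {x | exists a, forall k, G k x a} with G a scheme are the results of
   Souslin operations on measurable sets. *)
Definition scheme (G : nat -> X -> (nat -> nat) -> Prop) := forall k,
  (forall a, measurable [set x | G k x a]) /\
  exists n, forall x a b, (forall i, (i < n)%N -> a i = b i) ->
    G k x a -> G k x b.

(* Countably many schemes run in parallel, branch m being read at the indices
   s m; P m switches the m-th scheme off. *)
Lemma scheme_reindex (G : nat -> nat -> X -> (nat -> nat) -> Prop)
    (s : nat -> nat -> nat) (P : nat -> (nat -> nat) -> Prop) :
  (forall m, scheme (G m)) ->
  (forall m, exists n, forall a b, (forall i, (i < n)%N -> a i = b i) ->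
    P m a -> P m b) ->
  scheme (fun k x a => if unpickle k is Some p
    then P p.1 a -> G p.1 p.2 x (a \o s p.1) else True).
Proof.
move=> schG finP k; case: unpickle => [[m j]/=|]; last first.
  by split => [a|]; [rewrite [X in measurable X](_ : _ = setT)//;
    apply/seteqP; split
    |exists 0%N].
have [mG [n nG]] := schG m j; split => [a|].
  have [Pa|Pa] := pselect (P m a).
    rewrite [X in measurable X](_ : _ = [set x | G m j x (a \o s m)]) //.
    by apply/seteqP; split => x /=; [apply|].
  by rewrite [X in measurable X](_ : _ = setT)//; apply/seteqP;
    split => // x _ /= /Pa.
have [n' n'P] := finP m.
exists (maxn n' (\max_(i < n) (s m i).+1)) => x a b ab H Pb.
apply: nG (H _); last first.
  by apply: n'P Pb => i ni; rewrite ab// leq_max ni.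
move=> i ni /=; apply: ab; rewrite leq_max; apply/orP; right.
exact: (leq_bigmax (Ordinal ni)).
Qed.

(* The branch c carries the point b of the Baire space at its even indices. *)
Definition tree (B : set (X * baire)) := exists G, scheme G /\
  forall x b, B (x, b) <-> exists c, (forall i, c i.*2 = b i) /\
    forall k, G k x c.

(** All branches share the even coordinates, which carry [b]; the odd ones are distributed among the
    branches by [pickle]. *)
Let tree_bigcap (B : nat -> set (X * baire)) :
  (forall n, tree (B n)) -> tree (\bigcap_n B n).
Proof.
move=> /choice[G GP].
pose s (m i : nat) := if odd i then (pickle (m, i./2)).*2.+1 else i.
exists (fun k x a => if unpickle k is Some p
  then True -> G p.1 p.2 x (a \o s p.1) else True); split.
  apply: (@scheme_reindex G s (fun _ _ => True)) => [m|];
    first by have [] := GP m.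
  by exists 0%N.
move=> x b; split => [Bxb|[c [cb Gc]] m _]; last first.
  apply/((GP m).2 x b); exists (c \o s m); split => [i|k].
    by rewrite /= /s odd_double.
  by have := Gc (pickle (m, k)); rewrite pickleK/=; exact.
have /choice[c cP] m : exists c, (forall i, c i.*2 = b i) /\ forall k,
  G m k x c.
  by apply/(GP m).2; exact: Bxb.
exists (fun i => if odd i then
    if unpickle i./2 is Some p then c p.1 p.2.*2.+1 else 0%N else b i./2).
split => [i|k]; first by rewrite odd_double doubleK.
case: unpickle => // -[m j] _ /=.
rewrite (_ : _ \o _ = c m); first by have [] := cP m.
apply/funext => i; rewrite /= /s; have [oi|oi] := boolP (odd i).
  rewrite /= odd_double/= uphalf_double pickleK/=.
  by rewrite -[in RHS](odd_double_half i) oi.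
rewrite (negbTE oi) -[in RHS](odd_double_half i) (negbTE oi) add0n.
by rewrite (cP m).1.
Qed.

(** Coordinate 1 names the member of the union; the other odd coordinates are shifted by two to make
    room for it. *)
Let tree_bigcup (B : nat -> set (X * baire)) :
  (forall n, tree (B n)) -> tree (\bigcup_n B n).
Proof.
move=> /choice[G GP].
pose s (m i : nat) := if odd i then i.+2 else i.
exists (fun k x a => if unpickle k is Some p
  then a 1%N = p.1 -> G p.1 p.2 x (a \o s p.1) else True); split.
  apply: (@scheme_reindex G s (fun m a => a 1%N = m)) => m.
    by have [] := GP m.
  by exists 2%N => a b <-.
move=> x b; split => [[m _ /(GP m).2 [c [cb Gc]]]|[c [cb Gc]]]; last first.
  exists (c 1%N) => //; apply/(GP _).2; exists (c \o s (c 1%N)); split => [i|k].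
    by rewrite /= /s odd_double.
  by have := Gc (pickle (c 1%N, k)); rewrite pickleK/=; exact.
exists (fun i => if i == 1%N then m else if odd i then c i.-2 else c i).
split => [i|k].
  by rewrite odd_double cb; case: eqP => // i1; have := odd_double i;
    rewrite i1.
case: unpickle => // -[m' j] /= <-.
rewrite (_ : _ \o _ = c)//; apply/funext => i; rewrite /= /s.
have [oi|oi] := boolP (odd i); first by rewrite /= negbK oi.
by rewrite (negbTE oi); case: eqP => // i1; rewrite i1 in oi.
Qed.

(** The complement of a set with a tree need not have one. Asking for both makes the class closed
    under complement, hence a sigma-field, and it contains the generators. *)
Let trees := [set B : set (X * baire) | tree B /\ tree (~` B)].

Let sigma_algebra_trees : sigma_algebra setT trees.
Proof.
split.
- split.
    exists (fun _ _ _ => False); split => [k|x b].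
      split; last by exists 0%N.
      by move=> a; rewrite [X in measurable X](_ : _ = set0).
    by split => // -[c [_ /(_ 0%N)]].
  exists (fun _ _ _ => True); split => [k|x b].
    split; last by exists 0%N.
    by move=> a; rewrite [X in measurable X](_ : _ = setT).
  split => [_|_ []].
  by exists (fun i => b i./2); split => // i; rewrite doubleK.
- by move=> A [tA tCA]; rewrite setTD; split => //; rewrite setCK.
- move=> A tA; split; first by apply: tree_bigcup => n; have [] := tA n.
  by rewrite setC_bigcup; apply: tree_bigcap => n; have [] := tA n.
Qed.

Lemma tree_measurable (B : set (X * baire)) : measurable B -> tree B.
Proof.
suff : measurable `<=` trees by move=> /[apply] -[].
apply: smallest_sub => // C [[A mA <-]|[A mA <-]]; rewrite setTI.
  have tX A' : measurable A' -> tree (fst @^-1` A').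
    move=> mA'; exists (fun _ x _ => A' x); split.
      by move=> k; split; last exists 0%N.
    move=> x b; split => [A'x|[c [_ /(_ 0%N)]]]//=.
    by exists (fun i => b i./2); split => // i; rewrite doubleK.
  by split; [exact: tX|exact: tX (measurableC mA)].
suff : measurable `<=` [set A : set baire | trees (snd @^-1` A)] by exact.
have [t0 tC tU] := sigma_algebra_trees.
apply: smallest_sub => [|_ [n [m ->]]]; first split.
- by rewrite /= preimage_set0.
- by move=> A' /= /tC; rewrite !setTD.
- by move=> F /= /tU; rewrite preimage_bigcup.
- have tY (P : nat -> Prop) : tree (snd @^-1` [set b : baire | P (b n)]).
    exists (fun _ _ c => P (c n.*2)); split => [k|x b].
      split => [a|]; last by exists (n.*2).+1 => x a b <-.
      have [Pa|Pa] := pselect (P (a n.*2)).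
        by rewrite [X in measurable X](_ : _ = setT)//; apply/seteqP; split.
      by rewrite [X in measurable X](_ : _ = set0)//; apply/seteqP; split.
    split => [/= Pb|[c [cb /(_ 0%N)]]]/=; last by rewrite cb.
    by exists (fun i => b i./2); split => *; rewrite doubleK.
  split; first exact: (tY (fun i => i = m)).
  exact: (tY (fun i => i <> m)).
Qed.

Lemma souslin_scheme (A : set X) : souslin A ->
  exists G, scheme G /\ A = [set x | exists a, forall k, G k x a].
Proof.
move=> [B [/tree_measurable[G [schG BG]] ->]].
exists G; split => //; apply/seteqP; split => [x [a]|x [a Ga]].
  by move=> /BG[c [_ Gc]]; exists c.
by exists (fun i => a i.*2); apply/BG; exists a.
Qed.

Lemma scheme_measurable G : scheme G ->
  measurable [set z : X * baire | forall k, G k z.1 z.2].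
Proof.
move=> schG; rewrite (_ : [set _ | _] = \bigcap_k [set z | G k z.1 z.2]).
  apply: bigcapT_measurable => k; have [mG [n nG]] := schG k.
  exact: measurable_baire_finite nG.
by apply/seteqP; split => [z Gz k _|z Gz k]; [exact: Gz|exact: (Gz k I)].
Qed.

End schemes.

(** * Capacitability *)

Section compactness.

(* An ultrafilter plays the part of the diagonal extraction in Koenig's lemma. *)
Lemma bounded_sequences_agree (b : nat -> nat -> nat) (a : nat -> nat) :
  (forall n i, (i < n)%N -> (b n i <= a i)%N) ->
  exists c : nat -> nat, (forall i, (c i <= a i)%N) /\
    forall m, exists n, (m <= n)%N /\ forall i, (i < m)%N -> b n i = c i.
Proof.
move=> ba.
have [F [UF ooF]] := ultraFilterLemma (eventually_filter).
have Fge m : F [set n | (m <= n)%N] by apply: ooF; exists m.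
have /choice[c cF] i : exists v, F [set n | b n i = v].
  apply: contrapT => /forallNP H.
  (* If no value of coordinate [i] were taken along the ultrafilter, the indices avoiding all values
     below [M] would be large for every [M], against the bound [a i]. *)
  have K M : F [set n | forall v, (v < M)%N -> b n i <> v].
    elim: M => [|M IH]; first by apply: filterS (Fge 0%N) => n _ v.
    have [/H//|HM] := in_ultra_setVsetC [set n | b n i = M] UF.
    apply: filterS (filterI IH HM) => n /= [H1 H2] v.
    by rewrite ltnS leq_eqVlt => /predU1P[->//|]; exact: H1.
  have [n [/= Kn ni]] := filter_ex (filterI (K (a i).+1) (Fge i.+1)).
  exact: (Kn (b n i)) (ba _ _ ni) _.
exists c; split => [i|m].
  by have [n [/= <- ni]] := filter_ex (filterI (cF i) (Fge i.+1)); exact: ba.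
have K : F [set n | forall i, (i < m)%N -> b n i = c i].
  elim: m => [|m IH]; first by apply: filterS (Fge 0%N) => n _ v.
  apply: filterS (filterI IH (cF m)) => n /= [H1 H2] v.
  by rewrite ltnS leq_eqVlt => /predU1P[->//|]; exact: H1.
by have [n [/= mn Kn]] := filter_ex (filterI (Fge m) K); exists n.
Qed.

Variables (X : Type) (G : nat -> X -> (nat -> nat) -> Prop) (ord : nat -> nat).
Hypothesis ordG : forall k x a b, (forall i, (i < ord k)%N -> a i = b i) ->
  G k x a -> G k x b.

(* An outer approximation of the points having a branch below a; only the first
   n coordinates matter, so that it is a finite union of measurable sets. *)
Definition box n a := [set x | exists b,
  (forall i, (i < n)%N -> (b i <= a i)%N) /\
  forall k, (k < n)%N -> (ord k <= n)%N -> G k x b].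

Lemma box_decr a m n : (m <= n)%N -> box n a `<=` box m a.
Proof.
move=> mn x [b [ba Gb]]; exists b; split => [i im|k km om].
  by apply: ba; exact: leq_trans mn.
by apply: Gb; [exact: leq_trans mn|exact: leq_trans mn].
Qed.

Lemma box_fin n a b :
  (forall i, (i < n)%N -> a i = b i) -> box n a `<=` box n b.
Proof.
move=> ab x [c [ca Gc]]; exists c; split => // i ni.
by rewrite -ab// ca.
Qed.

(** The witness of the n-th box varies with [n]. Being bounded by [a], these witnesses have a limit
    [c] that agrees with some late witness on the coordinates read by [G k], for each [k]. *)
Lemma bigcap_box a :
  \bigcap_n box n a `<=` [set x | exists b, forall k, G k x b].
Proof.
move=> x Bx; have /choice[b bP] n := Bx n I.
have [c [_ cP]] : exists c : nat -> nat, (forall i, (c i <= a i)%N) /\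
    forall m, exists n, (m <= n)%N /\ forall i, (i < m)%N -> b n i = c i.
  by apply: bounded_sequences_agree => n i ni; exact: (bP n).1.
exists c => k; have [n [mn bc]] := cP (maxn k.+1 (ord k)).
move: mn; rewrite geq_max => /andP[kn on].
apply: ordG ((bP n).2 k kn on) => i io; apply: bc.
by rewrite leq_max io orbT.
Qed.

End compactness.

Lemma measurable_box d (X : measurableType d)
    (G : nat -> X -> (nat -> nat) -> Prop) ord :
  (forall k x a b, (forall i, (i < ord k)%N -> a i = b i) ->
    G k x a -> G k x b) ->
  (forall k a, measurable [set x | G k x a]) ->
  forall n a, measurable (box G ord n a).
Proof.
move=> ordG mG n a.
rewrite (_ : box G ord n a = \bigcup_(s : seq nat)
  (\bigcap_(k in [set k | [/\ k < n & ord k <= n]%N])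
    [set x | G k x (nth 0%N s)] `&`
   [set x | forall i, (i < n)%N -> (nth 0%N s i <= a i)%N])).
  apply: countable_bigcupT_measurable => // s; apply: measurableI.
    exact: bigcap_measurableType.
  have [H|H] := pselect (forall i, (i < n)%N -> (nth 0%N s i <= a i)%N).
    by rewrite [X in measurable X](_ : _ = setT)//; apply/seteqP; split.
  by rewrite [X in measurable X](_ : _ = set0)//; apply/seteqP; split.
apply/seteqP; split => [x [b [ba Gb]]|x [s _ [Gs sa]]]; last first.
  by exists (nth 0%N s); split => // k kn on; exact: Gs.
exists (mkseq b n) => //; split => [k [kn on]|i ni] /=.
  apply: ordG (Gb _ kn on) => i io; rewrite nth_mkseq//.
  exact: leq_trans on.
by rewrite nth_mkseq// ba.
Qed.

Lemma scheme_ord d (X : measurableType d)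
    (G : nat -> X -> (nat -> nat) -> Prop) :
  scheme G -> exists ord, forall k x a b,
    (forall i, (i < ord k)%N -> a i = b i) -> G k x a -> G k x b.
Proof. by move=> /all_and2[_ /choice[ord H]]; exists ord. Qed.

Section capacity.
Context {R : realType} d (X : measurableType d)
  (mu : {measure set X -> \bar R}) (muT : mu setT < +oo).

Lemma mu_ext_fin_num (E : set X) : (mu^*)%mu E \is a fin_num.
Proof.
rewrite ge0_fin_numE; last exact: outer_measure_ge0.
apply: le_lt_trans muT; rewrite -(measurable_mu_extE mu)//.
exact: le_mu_ext.
Qed.

Lemma mu_ext_le (E B : set X) : measurable B -> E `<=` B -> (mu^*)%mu E <= mu B.
Proof. by move=> mB EB; rewrite -(measurable_mu_extE mu)//;
  exact: le_mu_ext. Qed.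

Lemma measurable_hull (E : set X) :
  exists H, [/\ measurable H, E `<=` H & mu H = (mu^*)%mu E].
Proof.
have /choice[B BP] n : exists B, [/\ measurable B, E `<=` B &
    mu B <= (mu^*)%mu E + (n.+1%:R^-1)%:E].
  have : (mu^*)%mu E < (mu^*)%mu E + (n.+1%:R^-1)%:E.
    by rewrite lteDl ?mu_ext_fin_num// lte_fin.
  rewrite {1}/mu_ext => /ereal_inf_lt[_ [C [mC EC] <-] Cn].
  exists (\bigcup_k C k); split => //; first exact: bigcupT_measurable.
  apply: le_trans (ltW Cn); apply: measure_sigma_subadditive => //.
  exact: bigcupT_measurable.
have mB : measurable (\bigcap_n B n).
  by apply: bigcapT_measurable => n; have [] := BP n.
have EB : E `<=` \bigcap_n B n by move=> x Ex n _; have [_ + _] := BP n; exact.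
exists (\bigcap_n B n); split => //.
apply/eqP; rewrite eq_le; apply/andP; split; last exact: mu_ext_le.
apply/lee_addgt0Pr => e e0.
have [n ne] : exists n, (n.+1%:R^-1 < e)%R.
  by have /ltr_add_invr[n] := e0; exists n; rewrite add0r in p.
have [mBn _ Bn] := BP n.
apply: le_trans (le_trans _ Bn) _; last by rewrite leeD2l// lee_fin ltW.
by apply: le_measure; rewrite ?inE// => x; exact.
Qed.

(** Measurable hulls of increasing sets need not increase. The intersections [K m] of all later
    hulls do, still contain [E m], and have measure at most its outer measure; continuity from below
    then applies to them. *)
Lemma mu_ext_bigcup_lt (E : nat -> set X) (r : \bar R) :
  (forall m n, (m <= n)%N -> E m `<=` E n) ->
  r < (mu^*)%mu (\bigcup_n E n) -> exists n, r < (mu^*)%mu (E n).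
Proof.
move=> ndE; have /choice[H HP] n := measurable_hull (E n).
have mH n : measurable (H n) by have [] := HP n.
pose K m := \bigcap_(n in [set n | (m <= n)%N]) H n.
have mK m : measurable (K m) by exact: bigcap_measurableType.
apply: contraPP => /forallNP rE; apply/negP; rewrite -leNgt.
have EK : \bigcup_n E n `<=` \bigcup_n K n.
  move=> x [n _ Enx]; exists n => // m /= nm.
  by have [_ + _] := HP m; apply; exact: ndE Enx.
apply: le_trans (mu_ext_le _ EK) _; first exact: bigcupT_measurable.
apply: cvge_to_le (nondecreasing_cvg_mu mK _ _) _.
- exact: bigcupT_measurable.
- move=> m n mn; apply/subsetPset => x Kx k /= nk; apply: Kx.
  exact: leq_trans nk.
- apply: nearW => n /=; apply: (@le_trans _ _ (mu (H n))).
    by apply: le_measure; rewrite ?inE// => x; apply => /=.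
  by have [_ _ ->] := HP n; rewrite leNgt; apply/negP; exact: rE.
Qed.

Variables (G : nat -> X -> (nat -> nat) -> Prop) (ord : nat -> nat).
Hypothesis ordG : forall k x a b, (forall i, (i < ord k)%N -> a i = b i) ->
  G k x a -> G k x b.
Hypothesis mG : forall k a, measurable [set x | G k x a].

(* Choose the bounds a 0, a 1, .. one after the other: outer measure is
   continuous along nondecreasing unions. *)
Lemma capacity (r : \bar R) :
  r < (mu^*)%mu [set x | exists a, forall k, G k x a] ->
  exists a, forall n, r < mu (box G ord n a).
Proof.
move=> rA.
pose E (s : seq nat) := [set x | exists b,
  (forall i, (i < size s)%N -> (b i <= nth 0%N s i)%N) /\ forall k, G k x b].
have Enil : [set x | exists a, forall k, G k x a] = E [::].
  by apply/seteqP; split => x [a]; [exists a|move=> [_ Ga]; exists a].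
rewrite Enil in rA.
have Ercons s : E s = \bigcup_m E (rcons s m).
  apply/seteqP; split => [x [b [bs Gb]]|x [m _ [b [bs Gb]]]]; last first.
    exists b; split => // i si; have := bs i;
      rewrite size_rcons ltnS nth_rcons si.
    by apply; exact: ltnW.
  exists (b (size s)) => //; exists b; split => // i.
  rewrite size_rcons nth_rcons ltnS leq_eqVlt => /predU1P[->|si].
    by rewrite ltnn eqxx.
  by rewrite si bs.
have /choice[f fP] s : exists m, r < (mu^*)%mu (E s) ->
    r < (mu^*)%mu (E (rcons s m)).
  have [|] := pselect (r < (mu^*)%mu (E s)); last by exists 0%N.
  rewrite {1}Ercons => /mu_ext_bigcup_lt[|m rm]; last by exists m.
  move=> m n mn x [b [bs Gb]]; exists b; split => // i.
  rewrite size_rcons => si; move: (bs i);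
    rewrite size_rcons !nth_rcons => /(_ si).
  by case: ifP => // _; case: ifP => // _ /leq_trans; apply.
pose S := fix S n := if n is m.+1 then rcons (S m) (f (S m)) else [::].
have rS n : r < (mu^*)%mu (E (S n)) by elim: n => //= n; exact: fP.
have SE n : S n = mkseq (fun i => f (S i)) n.
  by elim: n => //= n IH; rewrite mkseqS -IH.
exists (fun i => f (S i)) => n; apply: lt_le_trans (rS n) _; apply: mu_ext_le.
  exact: measurable_box.
rewrite SE => x [b [bs Gb]]; exists b; split => // i ni.
by have := bs i; rewrite size_mkseq nth_mkseq//; exact.
Qed.

Lemma measure_bigcap_box (a : nat -> nat) (r : \bar R) :
  (forall n, r <= mu (box G ord n a)) -> r <= mu (\bigcap_n box G ord n a).
Proof.
move=> rb; have mb n : measurable (box G ord n a) by exact: measurable_box.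
apply: cvge_to_ge (nonincreasing_cvg_mu _ mb _ _) _ => //.
- by apply: le_lt_trans muT; apply: le_measure; rewrite ?inE.
- exact: bigcapT_measurable.
- by move=> m n mn; apply/subsetPset; exact: box_decr.
- exact: nearW.
Qed.

End capacity.

(** Capacitability gives measurable sets [K n] inside [A] whose measures approach that of the hull
    [H]. So [A] lies between the union of the [K n] and [H], which differ by a null set. *)
Lemma souslin_completed {R : realType} d (X : measurableType d)
    (mu : {measure set X -> \bar R}) (A : set X) :
  mu setT < +oo -> souslin A -> completed_algebra_gen mu A.
Proof.
move=> muT sA; apply/completed_algebra_genP.
have [G [schG AE]] := souslin_scheme sA.
have [ord ordG] := scheme_ord schG.
have mG k a : measurable [set x | G k x a] by have [] := schG k.
have [H [mH AH HE]] := measurable_hull muT A.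
have /choice[K KP] n : exists K, [/\ measurable K, K `<=` A &
    mu H <= mu K + (n.+1%:R^-1)%:E].
  have : (mu^*)%mu A - (n.+1%:R^-1)%:E < (mu^*)%mu A.
    by rewrite lteBlDr// lteDl ?mu_ext_fin_num// lte_fin.
  rewrite [X in _ < _ X -> _]AE => /(capacity muT ordG mG)[a ab].
  exists (\bigcap_n box G ord n a); split.
  - by apply: bigcapT_measurable => m; exact: measurable_box.
  - by rewrite AE; exact: bigcap_box.
  - rewrite HE -leeBlDr//; apply: measure_bigcap_box => // m.
    exact: ltW.
have mK : measurable (\bigcup_n K n).
  by apply: bigcupT_measurable => n; have [] := KP n.
have KA : \bigcup_n K n `<=` A by apply: bigcup_sub => n _; have [] := KP n.
exists (H `\` \bigcup_n K n); split; first exact: measurableD.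
- apply/eqP; rewrite eq_le measure_ge0 andbT.
  have muH : mu H < +oo by rewrite HE ltey_eq mu_ext_fin_num.
  rewrite measureD // (setIidr (subset_trans KA AH)).
  rewrite sube_le0.
  apply/lee_addgt0Pr => e e0.
  have [n ne] : exists n, (n.+1%:R^-1 < e)%R.
    by have /ltr_add_invr[n] := e0; exists n; rewrite add0r in p.
  have [mKn _ Kn] := KP n.
  apply: le_trans Kn _; apply: leeD; last by rewrite lee_fin ltW.
  by apply: le_measure; rewrite ?inE//; exact: bigcup_sup.
- rewrite [X in measurable X](_ : _ = \bigcup_n K n)//.
  apply/seteqP; split => x.
    by move=> [Ax]/not_andP[/(_ (AH _ Ax))//|/contrapT].
  by move=> Kx; split; [exact: KA|case].
Qed.

(** * Borel spaces as images of the Baire space *)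

Section standard_borel.
Context {R : realType}.

Let rad (n : nat) : R := n.+1%:R^-1.

Let rad_gt0 n : (0 < rad n)%R. Proof. by rewrite invr_gt0. Qed.

Let rad_lt (e : R) : (0 < e)%R -> exists n, (rad n < e)%R.
Proof.
by move=> /ltr_add_invr[n]; rewrite add0r => ?; exists n.
Qed.

Let rad_le m n : (m <= n)%N -> (rad n <= rad m)%R.
Proof. by move=> mn; rewrite lef_pV2 ?posrE// ler_nat. Qed.

Lemma hausdorff_ball_eq (P : pseudoMetricType R) (p q : P) :
  hausdorff_space P -> (forall e, (0 < e)%R -> ball p e q) -> p = q.
Proof.
rewrite ball_hausdorff => hP pq; apply: contrapT => /eqP /hP[[r s]] /= /eqP.
apply/eqP/set0P; exists q; split; first exact: pq.
exact: ballxx.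
Qed.

Lemma dense_sequence (P : completePseudoMetricType R) (D : set P) :
  countable D -> dense D ->
  exists d : nat -> P, forall p e, (0 < e)%R -> exists n, ball p e (d n).
Proof.
move=> /countable_injP[f finj] denseD.
have /choice[d dP] n : exists p, (exists2 q, D q & f q = n) -> D p /\ f p = n.
  have [[q Dq fq]|H] := pselect (exists2 q, D q & f q = n); first by exists q.
  by exists point.
exists d => p e e0.
have [q [pq Dq]] : (ball p e)^° `&` D !=set0.
  apply: denseD; last exact: open_interior.
  by exists p; apply: nbhsx_ballx.
exists (f q); have [|Dd fd] := dP (f q); first by exists q.
rewrite (finj _ _ _ _ fd) ?inE//; exact: interior_subset pq.
Qed.

Variable U : borelSpace R.

(* The codes of the points are the fast Cauchy sequences in a countable dense
   set. *)
Lemma borel_baire_surjection :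
  exists g : baire -> U, measurable_fun setT g /\ forall u, exists a, g a = u.
Proof.
case: U => X /= [P [e [[hP [D cD dD]] einj eR mX]]].
have [d dP] := dense_sequence cD dD.
pose C : set baire :=
  [set a | forall n m, (n <= m)%N -> ball (d (a n)) (rad n) (d (a m))].
have /choice[L LP] (a : baire) : exists p, C a ->
    forall n, ball (d (a n)) (rad n + rad n)%R p.
  have [Ca|] := pselect (C a); last by exists point.
  have cF : cvg ((d \o a) @ \oo).
    apply: cauchy_cvg; apply/cauchy_exP => eps eps0.
    have [n ne] := rad_lt eps0.
    exists (d (a n)); exists n => // m /= nm.
    by apply: le_ball (ltW ne) _ _; exact: Ca.
  have [p dap] : exists p : P, forall V, nbhs p V -> \forall m \near \oo,
    V (d (a m)).
    by exists (lim ((d \o a) @ \oo)) => V; exact: cF.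
  exists p => _ n.
  have : \forall m \near \oo, ball p (rad n) (d (a m)).
    by apply: dap; exact: nbhsx_ballx.
  move=> [m0 _ /(_ (maxn m0 n)) /=]; rewrite leq_maxl => /(_ isT) pm.
  apply: ball_triangle (ball_sym pm); apply: Ca; exact: leq_maxr.
(* Membership of the limit in an open set becomes a countable disjunction of conditions on single
   coordinates; this is what makes the coding map measurable. *)
have LV (V : set P) a : open V -> C a ->
    V (L a) <-> exists n, ball (d (a n)) (rad n + rad n)%R `<=` V.
  move=> oV Ca; split => [VL|[n]]; last by apply; exact: LP.
  have /nbhs_ballP[eps /= eps0 epsV] : nbhs (L a) V by exact: open_nbhs_nbhs.
  (* The divisor is 4: two radii separate the limit from [d (a n)], and two more separate the latter
     from [q]. *)
  have [n ne] := rad_lt (divr_gt0 eps0 (ltr0Sn R 3)).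
  exists n => q dq; apply: epsV.
  have : ball (L a) ((rad n + rad n) + (rad n + rad n))%R q.
    by apply: ball_triangle dq; apply: ball_sym; exact: LP.
  apply: le_ball; move: ne; rewrite ltr_pdivlMr// => /ltW; apply: le_trans.
  by have := rad_gt0 n; lra.
have mcoord n : measurable_fun setT (fun a : baire => a n).
  exact: measurable_baire_coord.
have mC : measurable C.
  rewrite (_ : C = \bigcap_n \bigcap_m [set a : baire | (n <= m)%N ->
      ball (d (a n)) (rad n) (d (a m))]); last first.
    by apply/seteqP; split => [a Ca n _ m _|a Ca n m]; [exact: Ca|exact: Ca].
  apply: bigcapT_measurable => n; apply: bigcapT_measurable => m.
  rewrite (_ : [set _ | _] = \bigcup_k (cylinder n k `&` (fun a : baire => a m)
      @^-1` [set j | (n <= m)%N -> ball (d k) (rad n) (d j)])).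
    apply: bigcupT_measurable => k; apply: measurableI.
      exact: measurable_cylinder.
    exact: preimage_measurable.
  by apply/seteqP; split => [a Ca|a [k _ [<-]]]//; exists (a n).
have mLV (V : set P) : <<s @open P>> V -> measurable (C `&` L @^-1` V).
  move: V; apply: smallest_sub => [|V oV].
    split => [|V mV|V mV] /=.
    - by rewrite preimage_set0 setI0.
    - rewrite setTD (_ : _ `&` _ = C `\` (C `&` L @^-1` V)).
        exact: measurableD.
      apply/seteqP; split => a /= [Ca VL]; split => //; first by case.
      by move=> Va; apply: VL.
    - by rewrite preimage_bigcup setI_bigcupr; exact: bigcupT_measurable.
  rewrite /= (_ : _ `&` _ = C `&` \bigcup_n ((fun a : baire => a n) @^-1`
      [set k | ball (d k) (rad n + rad n)%R `<=` V])).
    apply: measurableI => //; apply: bigcupT_measurable => n.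
    exact: preimage_measurable.
  apply/seteqP; split => a /= [Ca].
    by move=> /(LV _ _ oV Ca)[n nV]; split => //; exists n.
  by move=> [n _ nV]; split => //; apply/(LV _ _ oV Ca); exists n.
have /choice[i iP] p : exists u, range e p -> e u = p.
  have [[u _ <-]|H] := pselect (range e p); first by exists u.
  by exists point.
(* Sequences that are not fast Cauchy, or whose limit is outside the range of [e], are sent to
   [point]; hence the case distinction on [B' (e point)]. *)
pose g a := if pselect ((C `&` L @^-1` (range e)) a) then i (L a) else point.
exists g; split => [_ B|u].
  rewrite setTI [X in X B]mX => -[B' mB' <-].
  have mI := mLV _ (@measurableI _ (g_sigma_algebraType (@open P)) _ _ mB' eR).
  have [Bp|Bp] := pselect (B' (e point)).
    rewrite (_ : _ @^-1` _ = (C `&` L @^-1` (B' `&` range e)) `|`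
        ~` (C `&` L @^-1` range e)).
      by apply: measurableU => //; apply: measurableC; exact: mLV.
    apply/seteqP; split => a /=; rewrite /g; case: pselect => H.
    - by rewrite iP//; [move=> ?; left; case: H|case: H].
    - by right.
    - by rewrite iP//; [case=> [[_ []]//|/(_ H)]|case: H].
    - by [].
  rewrite (_ : _ @^-1` _ = C `&` L @^-1` (B' `&` range e))//.
  apply/seteqP; split => a /=; rewrite /g; case: pselect => H //.
  - by rewrite iP//; [case: H|case: H].
  - by move=> [Ca [B'L rL]]; rewrite iP.
  - by move=> [Ca [B'L rL]]; exfalso; apply: H.
(* Half the radius, so that the n-th and any later approximation of [e u] are within [rad n] of each
   other. *)
have /choice[a aP] n : exists k, ball (e u) (rad n / 2)%R (d k).
  by apply: dP; rewrite divr_gt0.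
have Ca : C a.
  move=> n m nm; have := ball_triangle (ball_sym (aP n)) (aP m).
  apply: le_ball; rewrite [leRHS](splitr (rad n)) lerD2l ler_pM2r//.
  exact: rad_le.
have La : L a = e u.
  apply/esym; apply: hausdorff_ball_eq => // eps eps0.
  have [n ne] := rad_lt (divr_gt0 eps0 (ltr0Sn R 3)).
  have := ball_triangle (aP n) (LP a Ca n).
  apply: le_ball; move: ne; rewrite ltr_pdivlMr// => /ltW; apply: le_trans.
  rewrite (splitr (rad n)).
  have := rad_gt0 n; lra.
exists a; rewrite /g; case: pselect => [H|]; last first.
  by case; split => //; rewrite /= La; exists u.
by apply: einj; rewrite iP La//; exists u.
Qed.

(** The generators are preimages of interiors of balls around a dense sequence with radii [rad n].
    Interiors are taken because the balls of a pseudometric structure need not be open. *)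
Lemma borel_countably_generated : countably_generated U.
Proof.
case: U => X /= [P [e [[hP [D cD dD]] einj eR mX]]].
have [d dP] := dense_sequence cD dD.
pose E k := if unpickle k is Some p then e @^-1` (ball (d p.1) (rad p.2))^°
  else set0.
exists E; apply/seteqP; split; last first.
  apply: smallest_sub; first exact: sigma_algebra_measurable.
  move=> _ [k _ <-]; rewrite /E; case: unpickle => [[j n]|]//.
  rewrite [X in X _]mX; exists (ball (d j) (rad n))^° => //.
  by apply: sub_sigma_algebra; exact: open_interior.
rewrite [X in X `<=` _]mX => _ [B mB <-]; move: B mB.
have [s0 sC sU] := smallest_sigma_algebra setT (range E).
apply: smallest_sub => [|V oV].
  split => [|V /sC|F /sU].
  - by rewrite /= preimage_set0.
  - by rewrite !setTD /= preimage_setC.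
  - by rewrite /= preimage_bigcup.
rewrite /= (_ : _ @^-1` _ = \bigcup_(k in [set k | E k `<=` e @^-1` V]) E k).
  rewrite bigcup_mkcond; apply: sU => k; case: ifP => // _.
  by apply: sub_sigma_algebra; exists k.
apply/seteqP; split => [u Vu|]; last by apply: bigcup_sub => k.
have /nbhs_ballP[eps /= eps0 epsV] : nbhs (e u) V by exact: open_nbhs_nbhs.
have [n ne] := rad_lt (divr_gt0 eps0 (ltr0Sn R 1)).
have [j uj] : exists k, ball (e u) (rad n / 2)%R (d k).
  by apply: dP; rewrite divr_gt0.
exists (pickle (j, n)); rewrite /E /= pickleK/=.
  move=> v /= /interior_subset jv; apply: epsV.
  have := ball_triangle uj jv; apply: le_ball.
  move: ne; rewrite ltr_pdivlMr// => /ltW; apply: le_trans.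
  by have := rad_gt0 n; lra.
rewrite /interior; apply/nbhs_ballP; exists (rad n / 2)%R => /= [|q uq].
  by rewrite divr_gt0.
by have := ball_triangle (ball_sym uj) uq; rewrite -splitr.
Qed.

End standard_borel.

Lemma analytic_souslin {R : realType} d (X : measurableType d) (A : set X) :
  @analytic R _ X A -> souslin A.
Proof.
move=> [Y [B [mB ->]]].
have [g [mg gsurj]] := borel_baire_surjection Y.
exists ((fun z : X * baire => (z.1, g z.2)) @^-1` B); split.
  apply: preimage_measurable => //; apply: measurable_fun_pair => //.
  exact: measurableT_comp.
apply/seteqP; split => [_ [[x y] Bxy <-]|x [a Bxa]].
  by have [a ay] := gsurj y; exists a; rewrite /= ay.
by exists (x, g a).
Qed.

Lemma souslin_proj {R : realType} d (X : measurableType d) (U : borelSpace R)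
    (A : set (X * U)) : souslin A -> souslin [set x | exists u, A (x, u)].
Proof.
move=> sA; have [g [mg gsurj]] := borel_baire_surjection U.
have : souslin ((fun z : X * baire => (z.1, g z.2)) @^-1` A).
  apply: souslin_preimage => //; apply: measurable_fun_pair => //.
  exact: measurableT_comp.
move=> /souslin_proj_baire; congr souslin.
apply/seteqP; split => x /= [a Aa]; first by exists (g a).
by have [b ba] := gsurj a; exists b; rewrite ba.
Qed.

(** * Measurable uniformization *)

(** A branch [c] interleaves three sequences: a code of the control at the indices 4i, the witness
    for the souslin set at 4i+2, and the auxiliary coordinates of the tree at the odd indices. A
    branch thus yields a control in a measurable way. *)
Lemma souslin_section_scheme {R : realType} d (X : measurableType d)
    (U : borelSpace R) (A : set (X * U)) : souslin A ->
  exists (G : nat -> X -> (nat -> nat) -> Prop) (h : baire -> U),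
    [/\ scheme G, measurable_fun setT h,
      forall x c, (forall k, G k x c) -> A (x, h c) &
      forall x u, A (x, u) -> exists c, forall k, G k x c].
Proof.
move=> sA; have [g [mg gsurj]] := borel_baire_surjection U.
have : souslin ((fun z : X * baire => (z.1, g z.2)) @^-1` A).
  apply: souslin_preimage => //; apply: measurable_fun_pair => //.
  exact: measurableT_comp.
move=> [B [mB AB]].
have ABP x b : A (x, g b) <-> exists c, B (x, b, c).
  have := congr1 (fun S => S (x, b)) AB => /= E.
  by split => [H|H]; [rewrite E in H|rewrite E].
have mcoord (f : nat -> nat) : measurable_fun setT
    (fun a : baire => (fun i => a (f i)) : baire).
  by apply: measurable_fun_baire => i; exact: measurable_baire_coord.
pose e : X * baire -> X * baire * baire := fun z =>
  (z.1, (fun i => z.2 i.*2) : baire, (fun i => z.2 i.*2.+1) : baire).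
have me : measurable_fun setT e.
  apply: measurable_fun_pair; first apply: measurable_fun_pair => //.
    exact: measurableT_comp (mcoord (fun i => i.*2)) measurable_snd.
  exact: measurableT_comp (mcoord (fun i => i.*2.+1)) measurable_snd.
have [G [schG GP]] := tree_measurable (preimage_measurable me mB).
exists G, (g \o (fun a : baire => (fun i => a i.*2.*2) : baire)); split => //.
- exact: measurableT_comp mg (mcoord (fun i => i.*2.*2)).
- move=> x c Gc; apply/ABP; exists (fun i => c i.*2.+1.*2).
  have : (e @^-1` B) (x, fun i => c i.*2) by apply/GP; exists c.
  exact.
- move=> x u Axu; have [b bu] := gsurj u.
  move: Axu; rewrite -bu => /ABP[c Bc].
  pose a i := if odd i then c i./2 else b i./2.
  have [|a' [_ Ga']] := (GP x a).1; last by exists a'.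
  rewrite /preimage /e /=.
  have -> : (fun i => a i.*2) = b.
    by apply/funext => i; rewrite /a odd_double doubleK.
  have -> : (fun i => a i.*2.+1) = c.
    by apply/funext => i; rewrite /a/= odd_double/= uphalf_double.
  by [].
Qed.

Section leftmost_branch.
Context d (X : measurableType d) (G : nat -> X -> (nat -> nat) -> Prop).
Hypothesis schG : scheme G.

Let subtree (s : seq nat) := [set x | exists c,
  (forall i, (i < size s)%N -> c i = nth 0%N s i) /\ forall k, G k x c].

Let souslin_subtree s : souslin (subtree s).
Proof.
exists ([set z : X * baire | forall k, G k z.1 z.2] `&`
  (setT `*` \bigcap_(i in [set i | (i < size s)%N]) cylinder i (nth 0%N s i))).
split.
  apply: measurableI; first exact: scheme_measurable.
  apply: measurableX => //; apply: bigcap_measurableType => i _.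
  exact: measurable_cylinder.
by apply/seteqP; split => x /= [c]; [move=> [H1 H2]|move=> [H2 [_ H1]]];
  exists c.
Qed.

(* For a measurable space Y that sees the souslin sets, the leftmost branch is
   measurable, because its prefixes are determined by membership in subtrees. *)
Lemma leftmost_branch : exists phi : X -> nat -> nat,
  (forall x, (exists c, forall k, G k x c) -> forall k, G k x (phi x)) /\
  forall d' (Y : measurableType d') (y : Y -> X),
    (forall A, souslin A -> measurable (y @^-1` A)) ->
    measurable_fun setT (fun z => phi (y z) : baire).
Proof.
have [ord ordG] := scheme_ord schG.
pose first x s m := subtree (rcons s m) x /\
  forall m', (m' < m)%N -> ~ subtree (rcons s m') x.
pose some x s := exists m, subtree (rcons s m) x.
have /choice[nx nxP] (z : X * seq nat) : exists m,
    (some z.1 z.2 -> first z.1 z.2 m) /\ (~ some z.1 z.2 -> m = 0%N).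
  have [[m0 m0P]|] := pselect (some z.1 z.2); last by exists 0%N.
  have ex : exists m, `[< subtree (rcons z.2 m) z.1 >] by exists m0;
    apply/asboolP.
  exists (ex_minn ex); split; last by case; exists m0.
  move=> _; case: ex_minnP => m1 /asboolP mP mmin; split => // m2 m21 /asboolP.
  by move=> /mmin; rewrite leqNgt m21.
pose p x := fix p n := if n is m.+1 then rcons (p m) (nx (x, p m)) else [::].
pose phi x n := nx (x, p x n).
have pE x n : p x n = mkseq (phi x) n.
  by elim: n => //= n IH; rewrite mkseqS -IH.
exists phi; split => [x exc k|d' Y y mY].
  have px n : subtree (p x n) x.
    elim: n => [|n [c [cp Gc]]]; first by have [c Gc] := exc; exists c.
    have [+ _] := nxP (x, p x n); case => //.
    exists (c (size (p x n))), c; split => // i.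
    rewrite size_rcons ltnS nth_rcons leq_eqVlt => /predU1P[->|si].
      by rewrite ltnn eqxx.
    by rewrite si cp.
  (* The branches witnessing the prefixes of [phi x] may all differ, but [G k] reads only [ord k]
     coordinates, so the one for that prefix settles it. *)
  have [c [cp Gc]] := px (ord k).
  apply: ordG (Gc k) => i io; rewrite cp pE ?size_mkseq//.
  by rewrite nth_mkseq.
have mst s : measurable (y @^-1` subtree s) by exact: mY.
have mnx s m : measurable [set z | nx (y z, s) = m].
  have mfirst : measurable [set z | first (y z) s m].
    rewrite (_ : [set _ | _] = y @^-1` subtree (rcons s m) `\`
        \bigcup_(m' in [set m' | (m' < m)%N]) y @^-1` subtree (rcons s m')).
      by apply: measurableD => //; exact: bigcup_measurable.
    apply/seteqP; split => z /= [H1 H2]; split => //.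
      by move=> [m' /= m'm]; exact: H2.
    by move=> m' m'm H; apply: H2; exists m'.
  have msome : measurable [set z | some (y z) s].
    rewrite (_ : [set _ | _] = \bigcup_m y @^-1` subtree (rcons s m)).
      exact: bigcupT_measurable.
    by apply/seteqP; split => z [m1]; exists m1.
  rewrite (_ : [set _ | _] = [set z | first (y z) s m] `|`
      (if m == 0%N then ~` [set z | some (y z) s] else set0)).
    apply: measurableU => //; case: ifP => // _; exact: measurableC.
  apply/seteqP; split => z /=.
    move=> <-; have [H1 H2] := nxP (y z, s).
    have [/H1|H] := pselect (some (y z) s); first by left.
    by right; rewrite (H2 H).
  have [H1 H2] := nxP (y z, s).
  case => [Hf|].
    have [N1 N2] := H1 (ex_intro _ m Hf.1).
    apply/eqP; rewrite eqn_leq; apply/andP; split; rewrite leqNgt; apply/negP.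
      by move=> /N2; apply; exact: Hf.1.
    by move=> /Hf.2; exact.
  by case: eqP => // -> /H2.
have mp n s : measurable [set z | p (y z) n = s].
  elim: n s => [|n IH] s.
    have [->|s0] := eqVneq s [::].
      by rewrite (_ : [set _ | _] = setT)//; apply/seteqP; split.
    rewrite (_ : [set _ | _] = set0)//; apply/seteqP; split => // z /= s0'.
    by rewrite -s0' in s0.
  (* Reversal exposes the last entry of [s], the one added at step [n]. *)
  rewrite (_ : [set _ | _] = if rev s is m :: r then
      [set z | p (y z) n = rev r] `&` [set z | nx (y z, rev r) = m] else set0).
    by case: (rev s) => // m r; exact: measurableI.
  apply/seteqP; split => z /=.
    by move=> <-; rewrite rev_rcons revK.
  case E : (rev s) => [//|m r] [pr nr].
  by rewrite pr nr -[s]revK E rev_cons.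
apply: measurable_fun_baire => n _ B _; rewrite setTI.
rewrite (_ : _ @^-1` _ = \bigcup_s \bigcup_(m in B)
    ([set z | p (y z) n = s] `&` [set z | nx (y z, s) = m])).
  apply: countable_bigcupT_measurable => // s; apply: bigcup_measurable => m _.
  exact: measurableI.
apply/seteqP; split => z.
  by move=> Bz; exists (p (y z) n) => //; exists (phi (y z) n).
by move=> [s _ [m Bm [ps nm]]]; rewrite /preimage/= /phi ps nm.
Qed.

End leftmost_branch.

(** This is the Jankov-von Neumann theorem. Souslin sets are measurable for the completion of every
    probability, so the leftmost branch is measurable for each completion, and the same map serves
    all of them. *)
Lemma souslin_uniformization {R : realType} d (X : measurableType d)
    (U : borelSpace R) (A : set (X * U)) : souslin A ->
  exists s : X -> U, universally_measurable R s /\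
    forall x, (exists u, A (x, u)) -> A (x, s x).
Proof.
move=> /souslin_section_scheme[G [h [schG mh GA AG]]].
have [phi [phiG mphi]] := leftmost_branch schG.
exists (h \o phi); split => [B mB P|x [u /AG exc]]; last exact/GA/phiG.
have := mphi _ (completed_type P) id; rewrite completed_measurableE.
have Pfin : P setT < +oo by rewrite probability_setT ltry.
move=> /(_ (fun S sS => souslin_completed Pfin sS)) mphi'.
have := preimage_measurable (measurableT_comp mh mphi') mB.
by rewrite completed_measurableE.
Qed.

(** * Lower semianalytic functions *)

Lemma souslin_bigcup_countable d (X : measurableType d) (I : countType)
    (A : I -> set X) : (forall i, souslin (A i)) -> souslin (\bigcup_i A i).
Proof.
move=> sA; rewrite (_ : \bigcup_i A i =
    \bigcup_n (if unpickle n is Some i then A i else set0)).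
  apply: souslin_bigcup => n; case: unpickle => [i|]//.
  exact: souslin_measurable.
apply/seteqP; split => x [i _].
  by exists (pickle i) => //; rewrite pickleK.
by case: unpickle => // j; exists j.
Qed.

Lemma souslin_setI d (X : measurableType d) (A B : set X) :
  souslin A -> souslin B -> souslin (A `&` B).
Proof.
move=> sA sB; rewrite (_ : A `&` B = \bigcap_n (if n is 0%N then A else B)).
  by apply: souslin_bigcap => -[].
apply/seteqP; split => [x [? ?] [|n]//|x H].
by split; [exact: (H 0%N I)|exact: (H 1%N I)].
Qed.

Section souslin_kernel.
Context {R : realType} d d' (Z : measurableType d) (W : measurableType d').

(* By capacity, the outer measure exceeds r iff for some rational q > r and some
   a all the boxes below a have measure >= q. *)
Lemma souslin_kernel (k : R.-fker Z ~> W) (A : set (Z * W)) (r : \bar R) :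
  souslin A -> souslin [set z | r < ((k z)^*)%mu [set w | A (z, w)]].
Proof.
move=> /souslin_scheme[G [schG ->]].
have [ord ordG] := scheme_ord schG.
have mG j a : measurable [set x | G j x a] by have [] := schG j.
have kfin z : k z setT < +oo.
  have [c kc] := measure_uub k; exact: lt_trans (kc z) (ltry _).
pose Gz z j w a := G j (z, w) a.
have ordGz z j w a b : (forall i, (i < ord j)%N -> a i = b i) ->
  Gz z j w a -> Gz z j w b by move=> ab; exact: ordG.
have mGz z j a : measurable [set w | Gz z j w a].
  exact: preimage_measurable (pair1_measurable z) (mG j a).
have mbox n a : measurable (box G ord n a) by exact: measurable_box.
have mboxz z n a : measurable (box (Gz z) ord n a).
  exact: measurable_box (@ordGz z) (@mGz z) n a.
have boxE z n a : box (Gz z) ord n a = [set w | box G ord n a (z, w)].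
  by apply/seteqP; split.
(* The margin [q] is needed because strict inequalities are lost in the limit over the boxes. *)
rewrite (_ : [set _ | _] = \bigcup_(q : rat)
    (if r < (ratr q)%:E then [set z | exists a, forall n,
      (ratr q)%:E <= k z (box (Gz z) ord n a)] else set0)).
  apply: souslin_bigcup_countable => q; case: ifP => [rq|_]; last first.
    exact: souslin_measurable.
  exists [set z : Z * baire | forall n,
    (ratr q)%:E <= k z.1 (box (Gz z.1) ord n z.2)].
  split => //; rewrite (_ : [set _ | _] = \bigcap_n
     [set z : Z * baire | (ratr q)%:E <= k z.1 (box (Gz z.1) ord n z.2)]);
       last first.
    by apply/seteqP; split => [z H n _|z H n]; [exact: H|exact: (H n I)].
  apply: bigcapT_measurable => n.
  apply: (@measurable_baire_finite _ _ n
    (fun z a => (ratr q)%:E <= k z (box (Gz z) ord n a))) => [a|z a b ab].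
    rewrite -[X in measurable X]setTI.
    apply: emeasurable_fun_c_infty => //.
    rewrite (_ : (fun z => _) = (fun z => k z (xsection (box G ord n a) z))).
      by apply: measurable_fun_xsection_finite_kernel; rewrite inE.
    apply/funext => z; congr (k z _); rewrite boxE.
    by apply/seteqP; split => w /=; rewrite /xsection/= inE.
  move=> /le_trans; apply; apply: le_measure; rewrite ?inE.
  - exact: mboxz.
  - exact: mboxz.
  - by apply: box_fin => i ni; rewrite ab.
apply/seteqP; split => z /=.
  move=> /lte_ratP[q [rq qA]]; exists q => //; rewrite rq.
  have [a aP] := capacity (kfin z) (@ordGz z) (@mGz z) qA.
  by exists a => n; exact: ltW.
move=> [q _]; case: ifP => // rq [a qa]; apply: (lt_le_trans rq).
apply: le_trans (measure_bigcap_box (kfin z) (@ordGz z) (@mGz z) qa) _.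
rewrite -(measurable_mu_extE (k z)); last first.
  by apply: bigcapT_measurable => n; exact: mboxz.
by apply: le_mu_ext; exact: (bigcap_box (@ordGz z)).
Qed.

End souslin_kernel.

Section souslin_functions.
Context {R : realType}.

(* Lower semianalytic, with souslin sets in place of analytic ones. *)
Definition slsa d (X : measurableType d) (phi : X -> \bar R) :=
  (forall x, 0 <= phi x) /\ forall c : R, souslin [set x | phi x < c%:E].

Lemma lower_semianalytic_slsa d (X : measurableType d) (phi : X -> \bar R) :
  lower_semianalytic phi -> slsa phi.
Proof. by move=> [phi0 aphi]; split => // c; exact: analytic_souslin. Qed.

Lemma slsa_comp d d' (X : measurableType d) (Y : measurableType d')
    (f : X -> Y) (phi : Y -> \bar R) :
  measurable_fun setT f -> slsa phi -> slsa (phi \o f).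
Proof.
move=> mf [phi0 sphi]; split => [x|c]; first exact: phi0.
exact: (souslin_preimage mf (sphi c)).
Qed.

Lemma slsa_cst0 d (X : measurableType d) : slsa (fun _ : X => 0 : \bar R).
Proof.
split=> // c; apply: souslin_measurable.
have [c0|c0] := ltP (0 : \bar R) c%:E.
  by rewrite (_ : [set _ | _] = setT)//; apply/seteqP; split.
by rewrite (_ : [set _ | _] = set0)//; apply/seteqP; split.
Qed.

Lemma slsaD d (X : measurableType d) (phi psi : X -> \bar R) :
  slsa phi -> slsa psi -> slsa (fun x => phi x + psi x).
Proof.
move=> [phi0 sphi] [psi0 spsi]; split => [x|c]; first exact: adde_ge0.
rewrite (_ : [set _ | _] = \bigcup_(q : rat)
   ([set x | phi x < (ratr q)%:E] `&` [set x | psi x < (c - ratr q)%:E])).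
  by apply: souslin_bigcup_countable => q; exact: souslin_setI.
apply/seteqP; split => x /=; last first.
  move=> [q _ [/= phiq psiq]]; have := lteD phiq psiq.
  by rewrite -EFinD subrKC.
have := phi0 x; have := psi0 x.
case E1 : (phi x) => [a| |]; case E2 : (psi x) => [b| |]//;
  rewrite -?EFinD ?lte_fin ?lee_fin => b0 a0 abc.
have /rat_in_itvoo[q] : (a < c - b)%R by rewrite ltrBrDr.
rewrite in_itv/= => /andP[aq qcb]; exists q => //; split;
  rewrite /= ?E1 ?E2 lte_fin//.
by rewrite ltrBrDr addrC -ltrBrDr.
Qed.

Lemma slsa_sum d (X : measurableType d) (I : Type) (s : seq I) (P : pred I)
    (phi : I -> X -> \bar R) :
  (forall i, P i -> slsa (phi i)) ->
  slsa (fun x => \sum_(i <- s | P i) phi i x).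
Proof.
move=> sphi; elim: s => [|i s IH].
  by under [X in slsa X]eq_fun do rewrite big_nil; exact: slsa_cst0.
under [X in slsa X]eq_fun do rewrite big_cons.
have [Pi|_] := boolP (P i) => //.
by apply: slsaD => //; exact: sphi.
Qed.

Lemma slsa_inf d (X : measurableType d) (U : borelSpace R)
    (phi : X * U -> \bar R) : slsa phi ->
  slsa (fun x => ereal_inf [set phi (x, u) | u in [set: U]]).
Proof.
move=> [phi0 sphi]; split => [x|c].
  by apply: le_ereal_inf_tmp => _ [u _ <-]; exact: phi0.
have := souslin_proj (sphi c); congr souslin; apply/seteqP; split => x /=.
  by move=> [u uc]; apply: le_lt_trans uc; apply: ereal_inf_lbound; exists u.
by move=> /ereal_inf_lt[_ [u _ <-] uc]; exists u.
Qed.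

Lemma slsa_completed_measurable d (X : measurableType d)
    (mu : {measure set X -> \bar R}) (phi : X -> \bar R) :
  mu setT < +oo -> slsa phi ->
  measurable_fun setT (phi : completed_type mu -> \bar R).
Proof.
move=> muT [_ sphi]; apply: measurable_fun_lt_rat => q; rewrite setTI.
by rewrite completed_measurableE; exact: souslin_completed.
Qed.

Lemma slsa_measurable d (X : measurableType d)
    (mu : {measure set X -> \bar R}) (phi : X -> \bar R) :
  mu setT < +oo -> slsa phi ->
  exists N, [/\ measurable N, mu N = 0 & measurable_fun (~` N) phi].
Proof.
move=> muT sphi; apply: completed_fun_measurable countably_generated_ereal _.
exact: slsa_completed_measurable.
Qed.

End souslin_functions.

(** * Staircase approximation of a nonnegative extended real *)

Section staircase.
Context {R : realType} (y : \bar R) (e : R).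
Hypotheses (y0 : 0 <= y) (e0 : (0 < e)%R).

Let stair (n : nat) : \bar R := if (n%:R * e)%:E <= y then e%:E else 0.

Let sum_stair_full n : (n%:R * e)%:E <= y ->
  \sum_(0 <= k < n.+1) stair k = (n.+1%:R * e)%:E.
Proof.
move=> ny; rewrite (@eq_big_nat _ _ _ _ _ _ (fun=> e%:E)) => [|k /= kn].
  by rewrite sumEFin sumr_const_nat subn0 mulr_natl.
rewrite /stair ifT//; apply: le_trans ny; rewrite lee_fin ler_pM2r// ler_nat.
by rewrite -ltnS.
Qed.

Lemma staircase_le n : \sum_(0 <= k < n) stair k <= y + e%:E.
Proof.
elim: n => [|n IH]; first by rewrite big_nil adde_ge0// lee_fin ltW.
have [ny|ny] := boolP ((n%:R * e)%:E <= y).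
  by rewrite sum_stair_full// -natr1 mulrDl mul1r EFinD leeD2r.
by rewrite big_nat_recr//= [stair n]/stair (negbTE ny) adde0.
Qed.

Lemma staircase_ge n : Order.min y (n%:R * e)%:E <= \sum_(0 <= k < n) stair k.
Proof.
elim: n => [|n IH]; first by rewrite big_nil ge_min mul0r lexx orbT.
have [ny|ny] := boolP ((n%:R * e)%:E <= y).
  by rewrite sum_stair_full// ge_min lexx orbT.
rewrite big_nat_recr//= [stair n]/stair (negbTE ny) adde0.
apply: le_trans IH; rewrite le_min; rewrite ge_min lexx/=.
by rewrite ge_min (ltW _) // ltNge.
Qed.

Lemma staircase_series : y <= \sum_(k <oo) stair k.
Proof.
have st0 k : 0 <= stair k by rewrite /stair; case: ifP => _;
  rewrite ?lee_fin ?lexx ?ltW.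
have ge n : Order.min y (n%:R * e)%:E <= \sum_(k <oo) stair k.
  by apply: le_trans (staircase_ge n) _; apply: nneseries_lim_ge.
have [[r yr]|yoo] : (exists r, y = r%:E) \/ y = +oo.
- by case: (y) y0 => [r _| _|//]; [left; exists r|right].
- have r0 : (0 <= r)%R by rewrite -lee_fin -yr.
  have := ge (Num.bound (r / e)); rewrite yr min_l// lee_fin.
  rewrite -ler_pdivrMr// ltW//.
  by apply: archi_boundP; rewrite divr_ge0// ltW.
- suff -> : \sum_(k <oo) stair k = +oo by rewrite leey.
  apply/eqyP => A A0; have := ge (Num.bound (A / e)).
  rewrite yoo min_r ?leey//; apply: le_trans.
  rewrite lee_fin -ler_pdivrMr// ltW//.
  by apply: archi_boundP; rewrite divr_ge0// ltW.
Qed.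

End staircase.

Section slsa_integral.
Context {R : realType}.

Lemma ge0_integral_null_patch d (W : measurableType d)
    (mu : {measure set W -> \bar R}) (N : set W) (f : W -> \bar R) :
  measurable N -> mu N = 0 -> (forall x, 0 <= f x) ->
  \int[mu]_x f x = \int[mu]_x (f \_ (~` N)) x.
Proof. by move=> mN N0 f0;
  rewrite (ge0_integral_setC_null mN N0 f0) integral_mkcond. Qed.

(** This is [e] times the measure of [{f >= k e}], written through the complement: [{f < k e}] is
    the souslin set, and an upper bound on the term is a lower bound on its outer measure, which is
    a souslin condition on the kernel parameter. *)
Let term d (W : measurableType d) (mu : set W -> \bar R) (f : W -> \bar R)
    (e : R) (k : nat) : \bar R :=
  e%:E * (1 - (mu^*)%mu [set w | f w < (k%:R * e)%:E]).

(* f <= sum_k e * 1{f >= k e} <= f + e *)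
Lemma integral_staircase d (W : measurableType d)
  (mu : {measure set W -> \bar R})
    (f : W -> \bar R) (e : R) :
  mu setT = 1 -> (0 < e)%R -> slsa f ->
  \int[mu]_w f w <= \sum_(k <oo) term mu f e k /\
  \sum_(k <oo) term mu f e k <= \int[mu]_w f w + e%:E.
Proof.
move=> mu1 e0 sf; have f0 := sf.1.
have muT : mu setT < +oo by rewrite mu1 ltry.
have [N [mN N0 mf]] := slsa_measurable muT sf.
have mNC : measurable (~` N) by exact: measurableC.
pose g := f \_ (~` N).
have mg : measurable_fun setT g by apply/(measurable_restrictT _ _).1.
have g0 w : 0 <= g w by rewrite /g patchE; case: ifP.
rewrite (ge0_integral_null_patch mN N0 f0) -/g.
pose st k w : \bar R := if (k%:R * e)%:E <= g w then e%:E else 0.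
have st0 k w : 0 <= st k w by rewrite /st; case: ifP => _;
  rewrite ?lee_fin ?lexx ?ltW.
have mst k : measurable_fun setT (st k).
  apply: measurable_fun_ifT => //.
  exact: measurable_fun_lee.
have termE k : term mu f e k = \int[mu]_w st k w.
  rewrite /term.
  have mlt : measurable [set w | g w < (k%:R * e)%:E].
    by rewrite -[X in measurable X]setTI; exact: emeasurable_fun_infty_o.
  rewrite (@mu_ext_completed _ _ _ mu _ N)//; last first.
    rewrite (_ : _ `\` _ = [set w | g w < (k%:R * e)%:E] `\` N).
      exact: measurableD.
    apply/seteqP; split => w /= [+ Nw]; rewrite /g patchE ifT ?inE//.
  rewrite (_ : [set w | f w < (k%:R * e)%:E] `\` N = [set w | g w < (k%:R *
    e)%:E] `\` N); last first.
    by apply/seteqP; split => w /= [+ Nw]; rewrite /g patchE ifT ?inE.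
  have -> : mu ([set w | g w < (k%:R * e)%:E] `\` N)
    = mu [set w | g w < (k%:R * e)%:E].
    apply/eqP; rewrite eq_le; apply/andP; split.
      by apply: le_measure; rewrite ?inE//; exact: measurableD.
    rewrite -[leRHS]adde0 -N0; apply: (@le_trans _ _ (mu
      (([set w | g w < (k%:R * e)%:E] `\` N) `|` N))); last first.
      by apply: measureU2 => //; exact: measurableD.
    apply: le_measure; rewrite ?inE//; first by apply: measurableU => //;
      exact: measurableD.
    by move=> w gw; have [Nw|Nw] := pselect (N w); [right|left].
  have -> : 1 - mu [set w | g w < (k%:R * e)%:E] = mu [set w | (k%:R * e)%:E <=
    g w].
    rewrite -mu1 -[in RHS](setTI [set w | (k%:R * e)%:E <= g w]).
    rewrite -[in LHS](setTI [set w | g w < (k%:R * e)%:E]) -measureD//.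
    by congr (mu _); apply/seteqP; split => w /= []; rewrite leNgt => _ /negP.
  have mge : measurable [set w | (k%:R * e)%:E <= g w].
    by rewrite -[X in measurable X]setTI; exact: emeasurable_fun_c_infty.
  rewrite -[X in mu X]setIT -integral_indic// -ge0_integralZl//; last 2 first.
  - exact/measurable_EFinP.
  - by rewrite lee_fin ltW.
  apply: eq_integral => w _; rewrite /st indicE.
  case: ifPn => H; first by rewrite mem_set// mule1.
  by rewrite memNset ?mule0//; exact/negP.
rewrite (eq_eseriesr (fun k _ => termE k)) -integral_nneseries//.
split.
  apply: ge0_le_integral_lower => // w; exact: staircase_series.
rewrite -(mule1 e%:E) -mu1 -integral_cst// -ge0_integralD//; last first.
  by move=> w _; rewrite lee_fin ltW.
apply: ge0_le_integral_lower => w; first exact: nneseries_ge0.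
apply: lime_le; first exact: is_cvg_nneseries.
by apply: nearW => n; exact: staircase_le.
Qed.

(** The integral is below [c] iff, for some step [e n] and some rational [q < c], all partial
    staircase sums are below [q]. Each partial sum is lower semianalytic in the parameter, and the
    quantifiers are countable. *)
Lemma slsa_integral d d' (Z : measurableType d) (W : measurableType d')
    (k : R.-pker Z ~> W) (phi : Z * W -> \bar R) :
  slsa phi -> slsa (fun z => \int[k z]_w phi (z, w)).
Proof.
move=> sphi; have phi0 := sphi.1.
have szphi z : slsa (fun w => phi (z, w)).
  exact: (slsa_comp (pair1_measurable z) sphi).
split => [z|c]; first exact: integral_ge0.
pose e (n : nat) : R := (n.+1%:R^-1)%R.
have e0 n : (0 < e n)%R by rewrite invr_gt0.
pose F n K z := \sum_(0 <= j < K) term (k z) (fun w => phi (z, w)) (e n) j.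
have le1 z A : ((k z)^*)%mu A <= 1.
  rewrite -(@prob_kernel _ _ _ _ _ k z) -(measurable_mu_extE (k z))//;
    exact: le_mu_ext.
have ge0 z A : 0 <= ((k z)^*)%mu A by exact: outer_measure_ge0.
have term0 n z j : 0 <= term (k z) (fun w => phi (z, w)) (e n) j.
  apply: mule_ge0; first by rewrite lee_fin ltW.
  rewrite subre_ge0 ?le1// ge0_fin_numE//.
have ltE n (a r : R) : (e n * (1 - a) < r)%R = (1 - r / e n < a)%R.
  by rewrite ltrBlDr -ltrBlDl [in RHS]ltr_pdivlMr// [in RHS]mulrC.
have sF n K : slsa (F n K).
  apply: slsa_sum => j _; split => // r.
  rewrite (_ : [set _ | _] = [set z | (1 - r / e n)%:E <
      ((k z)^*)%mu [set w | phi (z, w) < (j%:R * e n)%:E]]).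
    by apply: (@souslin_kernel _ _ _ _ _ k [set zw | phi zw < (j%:R * e
      n)%:E]); exact: sphi.2.
  apply/seteqP; split => z /=; rewrite /term;
    have := le1 z [set w | phi (z, w) < (j%:R * e n)%:E];
    have := ge0 z [set w | phi (z, w) < (j%:R * e n)%:E];
    case: (((k z)^*)%mu _) => [a| |]// a0 a1; rewrite -EFinB -EFinM !lte_fin;
    by rewrite ltE.
rewrite (_ : [set _ | _] = \bigcup_n \bigcup_(q : rat)
   (if (ratr q < c)%R then \bigcap_K [set z | F n K z < (ratr q)%:E] else
     set0)).
  apply: souslin_bigcup => n; apply: souslin_bigcup_countable => q.
  case: ifP => _; last exact: souslin_measurable.
  by apply: souslin_bigcap => K; exact: (sF n K).2.
have S z n := integral_staircase (@prob_kernel _ _ _ _ _ k z) (e0 n) (szphi z).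
apply/seteqP; split => z /=.
  move=> /lte_ratP[q [Iq qc]].
  have I0 : 0 <= \int[k z]_w phi (z, w) by exact: integral_ge0.
  have [n nq] : exists n, \int[k z]_w phi (z, w) + (e n)%:E < (ratr q)%:E.
    move: I0 Iq; case: (\int[k z]_w phi (z, w)) => [a| |]// _;
      rewrite lte_fin => aq.
    have /ltr_add_invr[n] : (a < ratr q)%R by [].
    by exists n; rewrite -EFinD lte_fin.
  exists n => //; exists q => //; rewrite lte_fin in qc; rewrite qc => K _ /=.
  apply: le_lt_trans nq; apply: le_trans (S z n).2.
  exact: nneseries_lim_ge.
move=> [n _ [q _]]; case: ifP => // qc Fq.
apply: le_lt_trans (S z n).1 _; apply: (@le_lt_trans _ _ (ratr q)%:E).
  apply: lime_le; first exact: is_cvg_nneseries.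
  by apply: nearW => K; exact: ltW (Fq K I).
by rewrite lte_fin.
Qed.

End slsa_integral.

(** * One-step laws and selectors *)

Section kernel_of.
Context {R : realType} d d' (X : measurableType d) (Y : measurableType d').
Variables (k : X -> {measure set Y -> \bar R})
  (mk : forall A, measurable A -> measurable_fun setT (k ^~ A))
  (k1 : forall x, k x setT = 1).

(** The proofs are arguments of the definition so that kernel structures can be attached to it. *)
Definition built_kernel
  of (forall A, measurable A -> measurable_fun setT (k ^~ A))
  & (forall x, k x setT = 1) : X -> {measure set Y -> \bar R} := k.

HB.instance Definition _ := isKernel.Build _ _ _ _ _ (built_kernel mk k1) mk.
HB.instance Definition _ :=
  Kernel_isProbability.Build _ _ _ _ _ (built_kernel mk k1) k1.

Lemma pker_of : exists k' : R.-pker X ~> Y, forall x, k' x = k x.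
Proof. by exists (built_kernel mk k1). Qed.

End kernel_of.

Section kernel_ops.
Context {R : realType} d d' (X : measurableType d) (Y : measurableType d').

Lemma pker_precomp d0 (Z : measurableType d0) (k : R.-pker X ~> Y)
  (p : Z -> X) :
  measurable_fun setT p -> exists k' : R.-pker Z ~> Y, forall z, k' z = k (p z).
Proof.
move=> mp; apply: (@pker_of _ _ _ Z Y (k \o p)) => [A mA|z];
  last exact: prob_kernel.
exact: measurableT_comp (measurable_kernel k A mA) mp.
Qed.

Lemma pker_pushforward d0 (Z : measurableType d0) (k : R.-pker X ~> Y)
    (g : X * Y -> Z) : measurable_fun setT g ->
  exists k' : R.-pker X ~> Z,
    forall x, k' x = pushforward (k x) (fun y => g (x, y)) :> (set Z -> \bar R).
Proof.
move=> mg.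
have mgx x : measurable_fun setT (fun y => g (x, y)).
  exact: measurableT_comp mg (pair1_measurable x).
have /choice[k0 k0E] x : exists m : {measure set Z -> \bar R},
    m = pushforward (k x) (fun y => g (x, y)) :> (set Z -> \bar R).
  unshelve (exists (pushforward (k x) (fun y => g (x, y)))) => //.
have [|x|k' k'E] := @pker_of _ _ _ X Z k0.
- move=> A mA.
  under eq_fun do rewrite k0E /pushforward.
  rewrite (_ : (fun x => _) = (fun x => k x (xsection (g @^-1` A) x))).
    apply: measurable_fun_xsection_finite_kernel; rewrite inE.
    exact: preimage_measurable.
  apply/funext => x; congr (k x _).
  by apply/seteqP; split => y; rewrite /xsection/= inE.
- by rewrite k0E /pushforward preimage_setT prob_kernel.
- by exists k' => x; rewrite k'E k0E.
Qed.

End kernel_ops.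

(** Off the null set [N] the map [g] coincides with a Borel map [g']. The law is [P] followed by the
    image of [k] under the graph of [g']; since [P N = 0], its formulas hold with [g] itself. *)
Lemma law_step {R : realType} d1 d2 d3 (X : measurableType d1)
    (U : measurableType d2) (W : measurableType d3) (k : R.-pker X ~> W)
    (P : {measure set X -> \bar R}) (g : X -> U) (N : set X) :
  P setT = 1 -> measurable N -> P N = 0 -> measurable_fun (~` N) g ->
  exists Q : {measure set (X * U * W) -> \bar R},
  [/\ Q setT = 1,
   forall A, measurable A ->
     Q A = \int[P]_x k x [set w | A (x, g x, w)] &
   forall f, (forall z, 0 <= f z) -> measurable_fun setT f ->
     \int[Q]_z f z = \int[P]_x \int[k x]_w f (x, g x, w)].
Proof.
move=> P1 mN N0 mg.
pose g' x := if x \in N then point else g x.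
have mg' : measurable_fun setT g'.
  move=> _ B mB; rewrite setTI.
  rewrite (_ : _ @^-1` _ = (~` N `&` g @^-1` B) `|`
      (if point \in B then N else set0)).
    by apply: measurableU; [exact: mg (measurableC mN) _ mB|case: ifP].
  apply/seteqP; split => x; rewrite /preimage/= /g'.
    case: ifPn => [|/negP Nx gB]; last by left; split => // /mem_set.
    by rewrite inE => Nx pB; right; rewrite ifT// inE.
  case=> [[Nx gB]|]; first by rewrite memNset.
  by case: ifPn => // /[1!inE] pB Nx; rewrite mem_set.
pose G (z : X * W) := (z.1, g' z.1, z.2).
have mG : measurable_fun setT G.
  apply: measurable_fun_pair => //; apply: measurable_fun_pair => //.
  exact: measurableT_comp.
have [k1 k1E] := pker_pushforward k mG.
(* [kcomp] composes kernels that share a parameter: the parameter space is reduced to one point, and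
   [P] becomes the constant kernel [l]. *)
have [k2 k2E] := pker_precomp k1 (@measurable_snd _ _ unit X).
have [l lE] : exists l : R.-pker unit ~> X, forall x, l x = P.
  by apply: (@pker_of _ _ _ unit X (fun _ => P)).
exists (kcomp l k2 tt).
have E0 f : (forall z, 0 <= f z) -> \int[P]_x \int[k x]_w f (x, g' x, w) =
    \int[P]_x \int[k x]_w f (x, g x, w).
  move=> f0; rewrite (ge0_integral_setC_null mN N0); last first.
    by move=> x; exact: integral_ge0.
  rewrite [RHS](ge0_integral_setC_null mN N0); last first.
    by move=> x; exact: integral_ge0.
  by apply: eq_integral => x; rewrite in_setC /g' => /negbTE ->.
have E1 f : (forall z, 0 <= f z) -> measurable_fun setT f ->
     \int[kcomp l k2 tt]_z f z = \int[P]_x \int[k x]_w f (x, g x, w).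
  move=> f0 mf; rewrite integral_kcomp// -E0//.
  transitivity (\int[P]_x \int[k2 (tt, x)]_z f z).
    by rewrite -(lE tt).
  apply: eq_integral => x _.
  transitivity (\int[pushforward (k x) (fun w => G (x, w))]_z f z).
    by rewrite -k1E -(k2E (tt, x)).
  rewrite ge0_integral_pushforward//.
  exact: measurableT_comp mG (pair1_measurable x).
have EA A : measurable A -> kcomp l k2 tt A = \int[P]_x k x [set w | A (x,
  g x, w)].
  move=> mA; rewrite -[in LHS](setIT A) -integral_indic// E1//; last first.
    exact/measurable_EFinP.
  rewrite -[LHS](E0 (fun z => (\1_A z)%:E))//.
  rewrite (ge0_integral_setC_null mN N0); last first.
    by move=> x; exact: integral_ge0.
  rewrite [RHS](ge0_integral_setC_null mN N0)//.
  apply: eq_integral => x; rewrite in_setC => Nx.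
  have -> : g x = g' x by rewrite /g' (negbTE Nx).
  have mAx : measurable [set w | A (x, g' x, w)].
    exact: (preimage_measurable (measurableT_comp mG (pair1_measurable x)) mA).
  by rewrite -[X in k x X]setIT -integral_indic//.
split => //.
transitivity (\int[P]_x k x [set w | [set: X * U * W] (x, g x, w)]).
  exact: EA.
transitivity (\int[P]_x cst 1 x); last first.
  by rewrite integral_cst// P1 mule1.
apply: eq_integral => x _; rewrite /=.
rewrite -[RHS](@prob_kernel _ _ _ _ _ k x); congr (k x _).
Qed.

(** * Functions measurable off a null set *)

Section almost_everywhere_measurable.
Context {R : realType} d (X : measurableType d)
  (mu : {measure set X -> \bar R}).

Lemma eq_integral_null (N : set X) (f g : X -> \bar R) :
  measurable N -> mu N = 0 -> (forall x, 0 <= f x) -> (forall x, 0 <= g x) ->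
  (forall x, ~ N x -> f x = g x) -> \int[mu]_x f x = \int[mu]_x g x.
Proof.
move=> mN N0 f0 g0 fg; rewrite (ge0_integral_setC_null mN N0 f0).
rewrite (ge0_integral_setC_null mN N0 g0).
by apply: eq_integral => x; rewrite inE => /fg.
Qed.

Definition ae_measurable (f : X -> \bar R) := exists N : set X,
  [/\ measurable N, mu N = 0 & measurable_fun (~` N) f].

Lemma ae_measurable_integralD (c : \bar R) (f : X -> \bar R) :
  mu setT = 1 -> 0 <= c -> (forall x, 0 <= f x) -> ae_measurable f ->
  \int[mu]_x (c + f x) = c + \int[mu]_x f x.
Proof.
move=> mu1 c0 f0 [N [mN N0 mf]].
have mNC : measurable (~` N) by exact: measurableC.
have g0 x : 0 <= (f \_ (~` N)) x by rewrite patchE; case: ifP.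
have fg x : ~ N x -> f x = (f \_ (~` N)) x by move=> Nx; rewrite patchE mem_set.
rewrite (@eq_integral_null N _ (fun x => c + (f \_ (~` N)) x)) //; last 3 first.
- by move=> x; exact: adde_ge0.
- by move=> x; exact: adde_ge0.
- by move=> x /fg <-.
rewrite (eq_integral_null mN N0 f0 g0 fg) ge0_integralD//; last first.
  by apply/(measurable_restrictT _ _).1.
by rewrite integral_cst// mu1 mule1.
Qed.

(** The bounds are 0 and [+oo] on the exceptional set. A formula known for Borel functions then
    passes to [f] by monotonicity, without following a null set through iterated integrals. *)
Lemma ae_measurable_sandwich (f : X -> \bar R) :
  (forall x, 0 <= f x) -> ae_measurable f ->
  exists f1 f2 : X -> \bar R, [/\
    measurable_fun setT f1 /\ measurable_fun setT f2,
    forall x, 0 <= f1 x, forall x, f1 x <= f x <= f2 x,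
    \int[mu]_x f1 x = \int[mu]_x f x & \int[mu]_x f2 x = \int[mu]_x f x].
Proof.
move=> f0 [N [mN N0 mf]].
have mNC : measurable (~` N) by exact: measurableC.
have mp : measurable_fun setT (f \_ (~` N))
  by apply/(measurable_restrictT _ _).1.
have f10 x : 0 <= (f \_ (~` N)) x by rewrite patchE; case: ifP.
pose f2 x := if x \in N then +oo else (f \_ (~` N)) x.
have f20 x : 0 <= f2 x by rewrite /f2; case: ifP.
exists (f \_ (~` N)), f2; split => //.
- split => //; apply: measurable_fun_ifT => //.
  apply: (measurable_fun_bool true); rewrite setTI.
  by rewrite (_ : _ @^-1` _ = N)//; apply/seteqP; split => x;
    [exact: set_mem|exact: mem_set].
- move=> x; rewrite /f2 patchE in_setC.
  by case: (x \in N) => //=; rewrite ?lexx ?f0 ?leey.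
- by apply: (eq_integral_null mN N0) => // x Nx; rewrite patchE mem_set.
- apply: (eq_integral_null mN N0) => // x Nx; rewrite /f2 memNset//.
  by rewrite patchE mem_set.
Qed.

End almost_everywhere_measurable.

Section probability_of.
Context {R : realType} d (X : measurableType d) (m : {measure set X -> \bar R}).

Definition built_probability of m setT = 1 : set X -> \bar R := m.

Variable m1 : m setT = 1.

HB.instance Definition _ := Measure.on (built_probability m1).
HB.instance Definition _ :=
  Measure_isProbability.Build _ _ _ (built_probability m1) m1.

Lemma probability_of : exists P : probability X R, P = m :> (set X -> \bar R).
Proof. by exists (built_probability m1). Qed.

End probability_of.

Section one_step.
Context {R : realType} d d' (X : measurableType d) (U : borelSpace R)
  (W : measurableType d') (k : R.-pker X ~> W).

Lemma slsa_ae_measurable d0 (Y : measurableType d0)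
  (mu : {measure set Y -> \bar R})
  (phi : Y -> \bar R) : mu setT = 1 -> slsa phi -> ae_measurable mu phi.
Proof. by move=> mu1; apply: slsa_measurable; rewrite mu1 ltry. Qed.

Lemma policy_step (P : probability X R) (g : X -> U) :
  universally_measurable R g ->
  exists Q : probability (X * U * W)%type R,
    (forall A, measurable A ->
      Q A = completed_integral P (fun x => k x [set w | A (x, g x, w)])) /\
    forall phi, slsa phi ->
      \int[Q]_z phi z = \int[P]_x \int[k x]_w phi (x, g x, w).
Proof.
move=> ug.
have [N [mN N0 mg]] : exists N, [/\ measurable N,
  P N = 0 & measurable_fun (~` N) g].
  apply: (@completed_fun_measurable _ _ _ P _ U g).
    exact: borel_countably_generated.
  by move=> _ B mB; rewrite setTI completed_measurableE; exact: ug.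
have [Q0 [Q01 QA Qf]] := law_step k (probability_setT P) mN N0 mg.
have [Q QE] := probability_of Q01.
exists Q; split => [A mA|phi sphi].
  by rewrite completed_integralE QE; exact: QA.
have phi0 := sphi.1.
have [f1 [f2 [[mf1 mf2] f10 f12 If1 If2]]] :=
  ae_measurable_sandwich phi0 (slsa_ae_measurable (probability_setT Q) sphi).
have f20 z : 0 <= f2 z by have /andP[] := f12 z; move=> _; exact: le_trans.
have QI f : (forall z, 0 <= f z) -> measurable_fun setT f ->
    \int[Q]_z f z = \int[P]_x \int[k x]_w f (x, g x, w).
  by move=> f0 mf; rewrite -Qf// QE.
apply/eqP; rewrite eq_le; apply/andP; split.
  rewrite -If1 QI//; apply: ge0_le_integral_lower => x;
    first exact: integral_ge0.
  by apply: ge0_le_integral_lower => w //; have /andP[] := f12 (x, g x, w).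
rewrite -If2 QI//; apply: ge0_le_integral_lower => x; first exact: integral_ge0.
by apply: ge0_le_integral_lower => w //; have /andP[] := f12 (x, g x, w).
Qed.

Variables (phi : X * U * W -> \bar R) (sphi : slsa phi).

Lemma slsa_stage_cost : slsa (fun xu : X * U => \int[k xu.1]_w phi (xu, w)).
Proof.
have [k' k'E] := pker_precomp k (@measurable_fst _ _ X U).
have := slsa_integral k' sphi; congr slsa; apply/funext => xu.
by rewrite k'E.
Qed.

Lemma slsa_stage_inf :
  slsa (fun x => ereal_inf [set \int[k x]_w phi (x, u, w) | u in [set: U]]).
Proof. exact: slsa_inf slsa_stage_cost. Qed.

(* Select in {F < (n + 1) e} for the least n that makes this possible. *)
Lemma stage_selector (e : R) : (0 < e)%R -> exists s : X -> U,
  universally_measurable R s /\ forall x, \int[k x]_w phi (x, s x, w) <=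
    ereal_inf [set \int[k x]_w phi (x, u, w) | u in [set: U]] + e%:E.
Proof.
move=> e0; pose F (xu : X * U) := \int[k xu.1]_w phi (xu, w).
have [F0 sF] := slsa_stage_cost.
pose A n := [set xu | F xu < (n.+1%:R * e)%:E].
have /choice[s sP] n := souslin_uniformization (sF (n.+1%:R * e)%R).
pose D n := [set x | exists u, A n (x, u)].
have sD n : souslin (D n) by exact: souslin_proj (sF _).
pose first x n := D n x /\ forall m, (m < n)%N -> ~ D m x.
have /choice[nx nxP] x : exists n, ((exists m, D m x) -> first x n) /\
    (~ (exists m, D m x) -> n = 0%N).
  have [[m0 m0P]|] := pselect (exists m, D m x); last by exists 0%N.
  have ex : exists m, `[< D m x >] by exists m0; apply/asboolP.
  exists (ex_minn ex); split; last by case; exists m0.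
  move=> _; case: ex_minnP => m1 /asboolP mP mmin; split => // m2 m21 /asboolP.
  by move=> /mmin; rewrite leqNgt m21.
exists (fun x => s (nx x) x); split => [B mB P|x].
  have Pfin : P setT < +oo by rewrite probability_setT ltry.
  have mD n : @measurable _ (completed_type P) (D n).
    by rewrite completed_measurableE; exact: souslin_completed.
  have mnx n : @measurable _ (completed_type P) [set x | nx x = n].
    rewrite (_ : [set _ | _] = (D n `\` \bigcup_(m in [set m | (m < n)%N]) D m)
      `|` (if n == 0%N then ~` (\bigcup_m D m) else set0)).
      apply: measurableU; first by apply: measurableD => //;
        exact: bigcup_measurable.
      by case: ifP => // _; apply: measurableC; exact: bigcupT_measurable.
    apply/seteqP; split => x /=.
      move=> <-; have [H1 H2] := nxP x.
      have [/H1[K1 K2]|H] := pselect (exists m, D m x).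
        by left; split => // -[m /= mn]; exact: K2.
      by right; rewrite (H2 H)/= => -[m _ Dm]; apply: H; exists m.
    have [H1 H2] := nxP x.
    case => [[Dn Dlt]|].
      have [N1 N2] := H1 (ex_intro _ n Dn).
      apply/eqP; rewrite eqn_leq; apply/andP; split; rewrite leqNgt; apply/negP.
        by move=> /N2; exact.
      by move=> lt; apply: Dlt; exists (nx x).
    case: eqP => // -> H; apply: H2 => -[m Dm]; apply: H; by exists m.
  rewrite -completed_measurableE.
  rewrite (_ : _ @^-1` _ = \bigcup_n ([set x | nx x = n] `&` s n @^-1` B)).
    apply: bigcupT_measurable => n; apply: measurableI => //.
    by rewrite completed_measurableE; exact: (sP n).1.
  apply/seteqP; split => [x Bx|x [n _ [/= <-]]]//.
  by exists (nx x).
have [ex|nex] := pselect (exists m, D m x).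
  have [N1 N2] := (nxP x).1 ex.
  have := (sP (nx x)).2 x N1 => /ltW /le_trans; apply.
  rewrite -natr1 mulrDl mul1r EFinD leeD2r//.
  apply: le_ereal_inf_tmp => _ [u _ <-].
  (* At level 0 the lower bound is 0; at a positive level, a control beating the bound would
     contradict minimality. *)
  case E : (nx x) => [|m]; first by rewrite mul0r; exact: F0 (x, u).
  rewrite leNgt; apply/negP => lt; apply: (N2 m); first by rewrite E.
  by exists u.
(* Here [x] is in no [D m], so every control costs [+oo] and any choice is optimal. *)
rewrite [leRHS](_ : _ = +oo) ?leey//.
rewrite (_ : ereal_inf _ = +oo) ?addye//.
apply/eqyP => a a0; apply: le_ereal_inf_tmp => _ [u _ <-].
rewrite leNgt; apply/negP => lt; apply: nex.
exists (Num.bound (a / e)); exists u; rewrite /A/= /F/=.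
apply: lt_trans lt _; rewrite lte_fin -ltr_pdivrMr//.
apply: (@lt_trans _ _ (Num.bound (a / e))%:R); last by rewrite ltr_nat.
by apply: archi_boundP; rewrite divr_ge0// ltW.
Qed.

End one_step.

(** * Dynamic programming on histories *)

Lemma slsa_integral_dirac {R : realType} d (X : measurableType d) (x : X)
    (f : X -> \bar R) : slsa f -> \int[\d_x]_y f y = f x.
Proof.
move=> sf; have d1 : \d_x [set: X] = 1 :> \bar R by exact: diracT.
have [f1 [f2 [[mf1 mf2] f10 f12 If1 If2]]] :=
  ae_measurable_sandwich sf.1 (slsa_ae_measurable d1 sf).
have /andP[f1x f2x] := f12 x.
have Id g : measurable_fun setT g -> \int[\d_x]_y g y = g x.
  by move=> mg; rewrite integral_dirac// diracT mul1e.
apply/eqP; rewrite eq_le; apply/andP; split.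
  by rewrite -If1 Id.
by rewrite -If2 Id.
Qed.

Lemma universally_measurable_cst {R : realType} d d' (X : measurableType d)
    (Y : measurableType d') (y : Y) : universally_measurable R (fun _ : X => y).
Proof.
move=> B mB P; rewrite -completed_measurableE; apply: measurable_completed.
by rewrite preimage_cst; case: ifP.
Qed.

Section dynamic_programming.
Context {R : realType} (U W : nat -> borelSpace R).
Variable rho : forall s, R.-pker (hist U W s) ~> (W s.+1).
Implicit Type gamma : forall s, hist U W s -> U s.

Definition stage_inf (s : nat) (phi : hist U W s.+1 -> \bar R)
  (h : hist U W s) :
    \bar R :=
  ereal_inf [set \int[rho s h]_w phi (h, u, w) | u in [set: U s]].

Definition admissible gamma s :=
  @universally_measurable R _ _ (hist U W s) (U s) (gamma s).

Definition law_of gamma r (h : hist U W r) m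
    (P : probability (hist U W (m + r)) R) :=
  forall A, measurable A -> policy_law rho gamma h (n := m) A = P A.

Lemma law_of0 gamma r (h : hist U W r) :
  law_of gamma h (m := 0) (dirac h : probability (hist U W r) R).
Proof. by []. Qed.

Lemma law_ofS gamma r (h : hist U W r) m (P : probability (hist U W (m + r))
  R) :
  admissible gamma (m + r) -> law_of gamma h P ->
  exists Q : probability (hist U W (m.+1 + r)) R,
    law_of gamma h (m := m.+1) Q /\
    forall phi : hist U W (m.+1 + r) -> \bar R, slsa phi ->
      \int[Q]_z phi z =
      \int[P]_h' \int[rho (m + r) h']_w phi (h', gamma (m + r)%N h', w).
Proof.
move=> ug lawP.
have [Q [QA Qphi]] := policy_step (rho (m + r)) P ug.
exists Q; split => // A mA; rewrite QA//=.
exact: eq_completed_integral.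
Qed.

Unset Implicit Arguments.
Variables (r n : nat) (J : forall s, hist U W s -> \bar R).
Hypothesis slsaJ : forall s, (r <= s <= n + r)%N -> slsa (J s).
Hypothesis JE : forall s h, (r <= s < n + r)%N ->
  J s h = stage_inf (J s.+1) h.

Set Implicit Arguments.

Let in_range m : (m < n)%N -> (r <= m + r < n + r)%N.
Proof. by move=> mn; rewrite leq_addl ltn_add2r. Qed.

Let in_range_le m : (m <= n)%N -> (r <= m + r <= n + r)%N.
Proof. by move=> mn; rewrite leq_addl leq_add2r. Qed.

(** Along any policy the expectation of [J] does not decrease in time, an infimum being at most the
    value at the chosen control. The law is produced in the same induction, because each step of the
    policy is integrated against the law built so far. *)
Lemma policy_cost_ge gamma (h : hist U W r) m : (m <= n)%N ->
  (forall s, (r <= s < n + r)%N -> admissible gamma s) ->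
  exists P : probability (hist U W (m + r)) R,
    law_of gamma h P /\ J r h <= \int[P]_h' J (m + r)%N h'.
Proof.
move=> + ug; elim: m => [_|m IH mn].
  exists (dirac h : probability (hist U W r) R); split; first exact: law_of0.
  have sJr : slsa (J r) by apply: slsaJ; rewrite leqnn leq_addl.
  by rewrite slsa_integral_dirac.
have [P [lawP JP]] := IH (ltnW mn).
have [Q [lawQ Qphi]] := law_ofS (ug _ (in_range mn)) lawP.
exists Q; split => //; apply: le_trans JP _.
rewrite Qphi; last exact: slsaJ (in_range_le mn).
apply: ge0_le_integral_lower => h'.
  have sJm : slsa (J (m + r)%N) by exact: slsaJ (in_range_le (ltnW mn)).
  exact: sJm.1.
rewrite JE; last exact: in_range.
by apply: ereal_inf_lbound; exists (gamma (m + r)%N h').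
Qed.

(** Each stage is played with a selector optimal up to [e], so the expectation of [J] rises by at
    most [e] per stage. One policy serves every [m], as the induction requires. *)
Lemma policy_cost_le (h : hist U W r) (e : R) : (0 < e)%R ->
  exists gamma, (forall s, admissible gamma s) /\
  forall m, (m <= n)%N -> exists P : probability (hist U W (m + r)) R,
    law_of gamma h P /\ \int[P]_h' J (m + r)%N h' <= J r h + (m%:R * e)%:E.
Proof.
move=> e0.
have ex s : exists g : hist U W s -> U s,
    @universally_measurable R _ _ (hist U W s) (U s) g /\
    ((r <= s < n + r)%N -> forall h', \int[rho s h']_w J s.+1 (h', g h', w) <=
      J s h' + e%:E).
  have [rs|] := boolP (r <= s < n + r)%N; last first.
    by exists (fun _ => point); split => //; exact: universally_measurable_cst.
  have sJ : slsa (J s.+1).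
    by apply: slsaJ; case/andP: rs => rs ->; rewrite andbT leqW.
  have [g [ug gP]] := stage_selector (rho s) sJ e0.
  by exists g; split => // _ h'; rewrite JE.
pose gamma s := sval (cid (ex s)).
have gammaP s := svalP (cid (ex s)).
exists gamma; split => [s|]; first exact: (gammaP s).1.
elim=> [_|m IH mn].
  exists (dirac h : probability (hist U W r) R); split; first exact: law_of0.
  have sJr : slsa (J r) by apply: slsaJ; rewrite leqnn leq_addl.
  by rewrite slsa_integral_dirac// mul0r adde0.
have [P [lawP JP]] := IH (ltnW mn).
have [Q [lawQ Qphi]] := law_ofS (gammaP (m + r)%N).1 lawP.
exists Q; split => //.
rewrite Qphi; last exact: slsaJ (in_range_le mn).
have sJm : slsa (J (m + r)%N) by exact: slsaJ (in_range_le (ltnW mn)).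
have sJm1 : slsa (J (m.+1 + r)%N) by exact: slsaJ (in_range_le mn).
apply: (@le_trans _ _ (\int[P]_h' (e%:E + J (m + r)%N h'))).
  apply: ge0_le_integral_lower => h'.
    by apply: integral_ge0 => w _; exact: sJm1.1.
  by rewrite addeC; exact: (gammaP _).2 (in_range mn) h'.
rewrite ae_measurable_integralD//; last 4 first.
- exact: probability_setT.
- by rewrite lee_fin ltW.
- exact: sJm.1.
- exact: slsa_ae_measurable (probability_setT P) sJm.
by rewrite addeC -natr1 mulrDl mul1r EFinD addeA leeD2r.
Qed.

Lemma dp_value (h : hist U W r) :
  ereal_inf [set completed_integral (policy_law rho gamma h (n := n))
    (J (n + r)%N)
    | gamma in policies U W r (n + r)] = J r h.
Proof.
apply/eqP; rewrite eq_le; apply/andP; split; last first.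
  apply: le_ereal_inf_tmp => _ [gamma ug <-].
  have [P [lawP JP]] := @policy_cost_ge gamma h n (leqnn n) ug.
  by rewrite (eq_completed_integral _ lawP) completed_integralE.
apply/lee_addgt0Pr => e e0.
have n0 : (0 < n.+1%:R :> R)%R by [].
(* The [n] stages lose at most [n] times [e / n.+1], hence at most [e]; the successor keeps the
   divisor positive when [n = 0]. *)
have [gamma [ug H]] := policy_cost_le h (divr_gt0 e0 n0).
have [P [lawP JP]] := H n (leqnn n).
apply: (@le_trans _ _ (J r h + (n%:R * (e / n.+1%:R))%:E)).
  apply: le_trans JP; rewrite -completed_integralE -(eq_completed_integral _
    lawP).
  by apply: ereal_inf_lbound; exists gamma => // s _; exact: ug.
rewrite leeD2l// lee_fin mulrCA ger_pMr// ler_pdivrMr// mul1r.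
by rewrite ler_nat.
Qed.

End dynamic_programming.

(** * Components of histories and casts between equal times *)

Section subhistories.
Context {R : realType} (U W : nat -> borelSpace R).

Lemma hist_castK s t (e : s = t) (h : hist U W s) :
  hist_cast (esym e) (hist_cast e h) = h.
Proof. by case: t / e. Qed.

Lemma hist_past_cat r n (h : hist U W r) (b : block U W r n) :
  hist_past (hist_cat h b) = h.
Proof. by elim: n b => //= n IH b; rewrite IH. Qed.

Lemma hist_future_cat r n (h : hist U W r) (b : block U W r n) :
  hist_future (hist_cat h b) = b.
Proof.
by elim: n b => [[]//|n IH [[b u] w]] /=; rewrite IH.
Qed.

(** [subhist] uses the length [t - r]; allowing any [n] with [n + r = t] makes the equation between
    times eliminable. *)
Lemma subhistE r t n (e : (n + r)%N = t) (rt : (r <= t)%N) (h : hist U W t) :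
  subhist rt h = hist_past (hist_cast (esym e) h).
Proof.
have nE : n = (t - r)%N by rewrite -e addnK.
by subst n; rewrite /subhist (eq_irrelevance e (subnK rt)).
Qed.

Lemma subhist_cast r t (e : r = t) (rt : (r <= t)%N) (h : hist U W r) :
  subhist rt (hist_cast e h) = h.
Proof. by rewrite (@subhistE r t 0 e) hist_castK. Qed.

Lemma subhist_id r (rr : (r <= r)%N) (h : hist U W r) : subhist rr h = h.
Proof. exact: (@subhist_cast r r erefl). Qed.

Lemma subhistS r s (rs : (r <= s)%N) (rs1 : (r <= s.+1)%N) (h : hist U W s)
    (u : U s) (w : W s.+1) :
  subhist rs1 ((h, u, w) : hist U W s.+1) = subhist rs h.
Proof.
have e : ((s - r) + r = s)%N by exact: subnK.
move: (s - r)%N e => n e; subst s.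
by rewrite (@subhistE r _ n erefl) (@subhistE r _ n.+1 erefl).
Qed.

Lemma subhist_join r t (rt rt' : (r <= t)%N) (h : hist U W r) b :
  subhist rt' (hist_join rt h b) = h.
Proof.
by rewrite /hist_join (@subhistE r t _ (subnK rt)) hist_castK hist_past_cat.
Qed.

Lemma subblock_join r t (rt rt' : (r <= t)%N) (h : hist U W r) b :
  subblock rt' (hist_join rt h b) = b.
Proof.
rewrite /subblock /hist_join (eq_irrelevance rt' rt) hist_castK.
exact: hist_future_cat.
Qed.

Lemma measurable_hist_cast s t (e : s = t) :
  measurable_fun setT (@hist_cast R U W s t e).
Proof. by case: t / e; exact: measurable_id. Qed.

Lemma measurable_hist_past r n : measurable_fun setT (@hist_past R U W r n).
Proof.
elim: n => [|n IH]; first exact: measurable_id.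
apply: (@measurableT_comp _ _ _ _ _ _ (@hist_past R U W r n)) => //.
exact: measurableT_comp measurable_fst measurable_fst.
Qed.

Lemma measurable_hist_future r n : measurable_fun setT (@hist_future R U W r n).
Proof.
elim: n => [|n IH]; first exact: measurable_cst.
apply: measurable_fun_pair; last exact: measurable_snd.
apply: measurable_fun_pair.
  apply: (@measurableT_comp _ _ _ _ _ _ (@hist_future R U W r n)) => //.
  exact: measurableT_comp measurable_fst measurable_fst.
exact: measurableT_comp measurable_snd measurable_fst.
Qed.

Lemma measurable_subhist r t (rt : (r <= t)%N) :
  measurable_fun setT (@subhist R U W r t rt).
Proof.
exact: measurableT_comp (@measurable_hist_past r _)
  (@measurable_hist_cast _ _ _).
Qed.

Lemma measurable_subblock r t (rt : (r <= t)%N) :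
  measurable_fun setT (@subblock R U W r t rt).
Proof.
exact: measurableT_comp (@measurable_hist_future r _)
  (@measurable_hist_cast _ _ _).
Qed.

End subhistories.

Lemma ereal_infD {R : realType} (I : pointedType) (c : \bar R)
  (g : I -> \bar R) :
  0 <= c -> (forall i, 0 <= g i) ->
  ereal_inf [set c + g i | i in [set: I]] = c + ereal_inf [set g i | i in [set:
    I]].
Proof.
move=> c0 g0; have i0 : 0 <= ereal_inf [set g i | i in [set: I]].
  by apply: le_ereal_inf_tmp => _ [i _ <-].
apply/eqP; rewrite eq_le; apply/andP; split; last first.
  apply: le_ereal_inf_tmp => _ [i _ <-]; rewrite leeD2l//.
  by apply: ereal_inf_lbound; exists i.
case: c c0 => [c| |]// c0;
  last by rewrite addye ?leey// gt_eqF// (lt_le_trans _ i0).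
rewrite addeC -leeBlDr//; apply: le_ereal_inf_tmp => _ [i _ <-].
rewrite leeBlDr// addeC.
by apply: ereal_inf_lbound; exists i.
Qed.

Lemma dp_value_until {R : realType} (U W : nat -> borelSpace R)
    (rho : forall s, R.-pker (hist U W s) ~> (W s.+1)) r T (rT : (r <= T)%N)
    (J : forall s, hist U W s -> \bar R) (h : hist U W r) :
  (forall s, (r <= s <= T)%N -> slsa (J s)) ->
  (forall s h, (r <= s < T)%N -> J s h = stage_inf rho (J s.+1) h) ->
  ereal_inf [set completed_integral (policy_law_until rho gamma rT h) (J T)
    | gamma in policies U W r T] = J r h.
Proof.
rewrite /policy_law_until; move: (subnK rT); move: (T - r)%N => n e.
case: T / e {rT} => slsaJ JE.
exact: (dp_value slsaJ JE).
Qed.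

(** * The recursion for a terminal cost on full histories *)

Section backward_recursion.
Context {R : realType} (U W : nat -> borelSpace R).
Variable rho : forall s, R.-pker (hist U W s) ~> (W s.+1).
Variables (T : nat) (phi : hist U W T -> \bar R).

(* The value 0 for s <> T is never used. *)
Definition terminal_cost s (h : hist U W s) : \bar R :=
  if s =P T is ReflectT e then phi (hist_cast e h) else 0.

Fixpoint backward n s : hist U W s -> \bar R :=
  if n is m.+1 then stage_inf rho (@backward m s.+1) else @terminal_cost s.

Definition cost_to_go s := @backward (T - s) s.
Arguments cost_to_go s _ : clear implicits.

Lemma cost_to_go_cast s (e : s = T) (h : hist U W s) :
  cost_to_go s h = phi (hist_cast e h).
Proof.
rewrite /cost_to_go (_ : T - s = 0)%N /=; last by rewrite e subnn.
by rewrite /terminal_cost; case: eqP => // e'; rewrite (eq_irrelevance e e').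
Qed.

Lemma cost_to_go_terminal : cost_to_go T = phi.
Proof. by apply/funext => h; exact: (@cost_to_go_cast _ erefl). Qed.

Lemma cost_to_goE s : (s < T)%N -> cost_to_go s = stage_inf rho (cost_to_go
  s.+1).
Proof. by move=> sT; rewrite /cost_to_go -(subnSK sT). Qed.

Hypothesis sphi : slsa phi.

Lemma slsa_cost_to_go s : (s <= T)%N -> slsa (cost_to_go s).
Proof.
move=> sT; have [n nE] : exists n, n = (T - s)%N by exists (T - s)%N.
elim: n s sT nE => [|n IH] s sT nE.
  have e : s = T by apply/eqP; rewrite eqn_leq sT -subn_eq0 -nE.
  by subst s; rewrite cost_to_go_terminal.
have sT' : (s < T)%N by rewrite -subn_gt0 -nE.
have nE' : n = (T - s.+1)%N by move: nE; rewrite -(subnSK sT') => -[].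
by rewrite cost_to_goE//; exact: (slsa_stage_inf (rho s) (IH s.+1 sT' nE')).
Qed.

Lemma cost_to_go_policies r (rT : (r <= T)%N) (h : hist U W r) :
  ereal_inf [set completed_integral (policy_law_until rho gamma rT h) phi
    | gamma in policies U W r T] = cost_to_go r h.
Proof.
rewrite -cost_to_go_terminal;
  apply: dp_value_until => [s /andP[_ sT]|s h' /andP[_ sT]].
  exact: slsa_cost_to_go.
by rewrite cost_to_goE.
Qed.

End backward_recursion.

(** * State reduction *)

Section reduction.
Context {R : realType} (U W X : nat -> borelSpace R) (N T : nat).
Variable t : time_grid N T.
Variable theta : forall i, hist U W (t i) -> X i.
Variable f : forall i, X i * time_block U W t i -> X i.+1.
Variable rho : forall s, R.-pker (hist U W s) ~> (W s.+1).
Variable rhot : forall i n,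
  R.-pker (X i * block U W (t i) n) ~> (W (n + t i).+1).
Variable ell : forall i, X i * time_block U W t i -> \bar R.
Variable ellN : X N -> \bar R.
Hypothesis reduction : is_state_reduction theta f.
Hypothesis compatible : compatible_kernels theta rho rhot.
Hypothesis ell_slsa : forall i, (i < N)%N -> slsa (ell (i := i)).
Hypothesis ellN_slsa : slsa ellN.

Lemma cost_to_go_castE (phi : hist U W T -> \bar R) s s' (e : s = s')
    (h : hist U W s) :
  cost_to_go rho phi h = cost_to_go rho phi (hist_cast e h).
Proof. by case: s' / e. Qed.

(** [nested_inf] peels from the inside, so the induction generalizes [psi]. The innermost stage at
    [hist_cat h b] integrates, by compatibility, against [rhot] at [(theta h, b)], and so again
    depends on [h] through [theta h] only. *)
Lemma nested_inf_cost_to_go (phi : hist U W T -> \bar R)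
  i (h : hist U W (t i)) n
    (psi : block U W (t i) n -> \bar R) :
  (i < N)%N -> (n <= t i.+1 - t i)%N -> (n + t i <= T)%N ->
  (forall b, cost_to_go rho phi (hist_cat h b) = psi b) ->
  cost_to_go rho phi h = nested_inf rhot (theta h) psi.
Proof.
move=> iN; elim: n psi => [|n IH] psi nt nT Jpsi.
  exact: (Jpsi tt).
apply: IH => [||b]; [exact: ltnW|exact: ltnW|].
rewrite cost_to_goE//; congr ereal_inf; apply: eq_imagel => u _.
rewrite (eq_completed_integral _ (m2 := rho (n + t i) (hist_cat h b))).
  by rewrite completed_integralE; apply: eq_integral => w _;
    exact: (Jpsi (b, u, w)).
by move=> A mA; rewrite compatible.
Qed.

Definition block_cost i (iN : (i < N)%N) s (ts : (t i.+1 <= s)%N)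
  (h : hist U W s) :=
  ell (theta (subhist (leq_trans (ltnW (node_lt t iN)) ts) h),
       subblock (ltnW (node_lt t iN)) (subhist ts h)).

Lemma slsa_tail_cost i : slsa (tail_cost theta ell ellN i).
Proof.
have [mtheta _ _] := reduction.
apply: slsaD; last first.
  apply: (slsa_comp _ ellN_slsa); apply: measurableT_comp (mtheta _ _) _ => //.
  exact: measurable_subhist.
apply: slsa_sum => k _; apply: (slsa_comp _ (ell_slsa (ltn_ord k))).
apply: measurable_fun_pair.
  apply: measurableT_comp (mtheta _ _) _; first exact: ltnW.
  exact: measurable_subhist.
exact: measurableT_comp (@measurable_subblock _ _ _ _ _ _)
  (@measurable_subhist _ _ _ _ _ _).
Qed.

Lemma tail_cost_rec i (iN : (i < N)%N) (h : hist U W T) :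
  tail_cost theta ell ellN i h =
  block_cost iN (node_leT t iN) h + tail_cost theta ell ellN i.+1 h.
Proof.
rewrite /tail_cost (bigD1 (Ordinal iN))//= -addeA; congr (_ + (_ + _)).
- by rewrite /block_cost; congr (ell (theta (subhist _ h),
    subblock _ (subhist _ h))); exact: eq_irrelevance.
- by apply: eq_bigl => k; rewrite -val_eqE/= ltn_neqAle eq_sym andbC.
Qed.

(** Once block [i] is over, its cost is a nonnegative constant, possibly [+oo]. It passes through
    expectations because the kernels have mass 1, and through infima because the remaining costs are
    nonnegative. *)
Lemma cost_to_go_block i (iN : (i < N)%N) s (ts : (t i.+1 <= s)%N)
  (sT : (s <= T)%N)
    (h : hist U W s) :
  cost_to_go rho (tail_cost theta ell ellN i) h =
  block_cost iN ts h + cost_to_go rho (tail_cost theta ell ellN i.+1) h.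
Proof.
have [n nE] : exists n, n = (T - s)%N by exists (T - s)%N.
elim: n s ts sT h nE => [|n IH] s ts sT h nE.
  have e : s = T by apply/eqP; rewrite eqn_leq sT -subn_eq0 -nE.
  subst s; rewrite !cost_to_go_terminal tail_cost_rec.
  by rewrite (eq_irrelevance ts (node_leT t iN)).
have sT' : (s < T)%N by rewrite -subn_gt0 -nE.
have nE' : n = (T - s.+1)%N by move: nE; rewrite -(subnSK sT') => -[].
have ts' : (t i.+1 <= s.+1)%N by exact: leqW.
have sJ : slsa (cost_to_go rho (tail_cost theta ell ellN i.+1) (s := s.+1)).
  by apply: slsa_cost_to_go => //; exact: slsa_tail_cost.
have costE k := @cost_to_goE _ _ _ rho _ (tail_cost theta ell ellN k) s sT'.
rewrite (costE i) (costE i.+1) -ereal_infD.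
- congr ereal_inf; apply: eq_imagel => u _.
  rewrite -ae_measurable_integralD.
  + apply: eq_integral => w _; rewrite (IH _ ts')//.
    rewrite /block_cost (@subhistS _ _ _ _ _ ts).
    by rewrite (@subhistS _ _ _ _ _ (leq_trans (ltnW (node_lt t iN)) ts)).
  + exact: prob_kernel.
  + exact: (ell_slsa iN).1.
  + by move=> w; exact: sJ.1.
  + apply: slsa_ae_measurable; first exact: prob_kernel.
    exact: (slsa_comp (pair1_measurable (h, u)) sJ).
- exact: (ell_slsa iN).1.
- by move=> u; apply: integral_ge0 => w _; exact: sJ.1.
Qed.

(** The induction is on the number of remaining blocks. At the end of block [i] the cost-to-go is
    the block cost plus the next reduced value at [theta] of the new history, which the state
    dynamics rewrite as [f (theta h, b)]: exactly the integrand of [bellman]. *)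
Lemma cost_to_go_reduced (Vt : forall i, X i -> \bar R) :
  is_reduced_value_function f rhot ell ellN Vt ->
  forall i, (i <= N)%N -> forall h : hist U W (t i),
    cost_to_go rho (tail_cost theta ell ellN i) h = Vt i (theta h).
Proof.
move=> [VtN VtE] i iN;
  have [n nE] : exists n, n = (N - i)%N by exists (N - i)%N.
elim: n i iN nE => [|n IH] i iN nE h.
  have e : i = N by apply/eqP; rewrite eqn_leq iN -subn_eq0 -nE.
  subst i; rewrite (@cost_to_go_cast _ _ _ _ _ _ _ (nodeN t)).
  rewrite /tail_cost big1 => [|k]; last by rewrite leqNgt ltn_ord.
  by rewrite add0e subhist_cast VtN.
have iN' : (i < N)%N by rewrite -subn_gt0 -nE.
have nE' : n = (N - i.+1)%N by move: nE; rewrite -(subnSK iN') => -[].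
rewrite VtE// /bellman.
have le := ltnW (node_lt t iN').
apply: nested_inf_cost_to_go => // [|b]; first by rewrite subnK// node_leT.
(* [hist_cat] ends at time [(t i.+1 - t i) + t i], equal to [t i.+1] only up to a cast, which
   [hist_join] performs. *)
transitivity (cost_to_go rho (tail_cost theta ell ellN i) (hist_join le h b)).
  exact: cost_to_go_castE.
rewrite (@cost_to_go_block _ iN' _ (leqnn _))//; last exact: node_leT.
rewrite IH//; congr (_ + _).
  by rewrite /block_cost subhist_id subhist_join subblock_join.
have [_ _ red] := reduction; congr (Vt _ _); rewrite -red.
by congr (theta (hist_join _ h b)); exact: eq_irrelevance.
Qed.

End reduction.

Theorem theorem8 (R : realType) (N T : nat)
  (N_gt0 : (0 < N)%N) (T_gt0 : (0 < T)%N) (t : time_grid N T)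
  (U W X : nat -> borelSpace R)
  (rho : forall s, R.-pker (hist U W s) ~> (W s.+1))
  (theta : forall i, hist U W (t i) -> X i)
  (f : forall i, X i * time_block U W t i -> X i.+1)
  (reduction : is_state_reduction theta f)
  (rhot : forall i n, R.-pker (X i * block U W (t i) n) ~> (W (n + t i).+1))
  (compatible : compatible_kernels theta rho rhot)
  (ell : forall i, X i * time_block U W t i -> \bar R)
  (ellN : X N -> \bar R)
  (ell_lsa : forall i, (i < N)%N -> lower_semianalytic (ell i))
  (ellN_lsa : lower_semianalytic ellN)
  (V : forall i, hist U W (t i) -> \bar R)
  (V_value : is_value_function theta rho ell ellN V)
  (Vt : forall i, X i -> \bar R)
  (Vt_value : is_reduced_value_function f rhot ell ellN Vt) :
  forall i, (i <= N)%N -> V i = Vt i \o theta i.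
Proof.
move=> i; rewrite leq_eqVlt => /predU1P[->|iN]; apply/funext => h /=.
  by rewrite V_value.1 Vt_value.1.
have ell_slsa k : (k < N)%N -> slsa (ell k).
  by move=> kN; exact: lower_semianalytic_slsa (ell_lsa k kN).
have ellN_slsa := lower_semianalytic_slsa ellN_lsa.
rewrite -(cost_to_go_reduced reduction compatible ell_slsa ellN_slsa Vt_value
  (ltnW iN)).
rewrite V_value.2; apply: cost_to_go_policies.
exact: slsa_tail_cost reduction ell_slsa ellN_slsa i.
Qed.
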